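(* Let $E$ be a (complex) JB$^*$-triple (respectively, a (real) J$^*$B-triple), let $F$ be a normed Jordan triple with canonical completion $\widehat{F}$, and let $T:E\rightarrow F$ be a triple monomorphism, not assumed to be continuous. Let $\sigma_{\widehat F}(T)$ be the separating space of $T$ in $\widehat F$, i.e. the set of all $z\in\widehat F$ for which there is a sequence $(x_n)$ in $E$ with $x_n\to 0$ and $T(x_n)\to z$. Then the norm closure of $T(E)$ in $\widehat{F}$ decomposes as the direct sum of $T(E)$ and $\sigma_{\widehat F}(T)$.
   Context: A real (resp., complex) normed Jordan triple is a real (resp., complex) normed space $E$ (not necessarily complete) with a non-trivial (jointly) continuous triple product $E\times E\times E\to E$, $(x,y,z)\mapsto\{x,y,z\}$, which is bilinear and symmetric in the outer variables $x,z$, linear (resp., conjugate linear) in the middle variable $y$, and satisfies the Jordan identity $L(a,b)L(x,y)-L(x,y)L(a,b)=L(L(a,b)x,y)-L(x,L(b,a)y)$ for all $a,b,x,y\in E$, where $L(x,y)z:=\{x,y,z\}$. A Jordan-Banach triple is a normed Jordan triple whose norm is complete; every normed Jordan triple can be completed in the usual way to a Jordan-Banach triple. Without further specification, these terms mean a real or complex one. For a normed Jordan triple $E$, $N(E):=\sup\{\|\{x,y,z\}\|:\|x\|,\|y\|,\|z\|\le 1\}$. A (complex) JB$^*$-triple is a complex Jordan-Banach triple $E$ such that (1) for each $a\in E$, $L(a,a)$ is a hermitian operator on $E$ with non-negative spectrum; (2) $\|\{a,a,a\}\|=\|a\|^3$ for all $a\in E$. A (real) J$^*$B-triple is a real Jordan-Banach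 triple $E$ such that $\|\{a,a,a\}\|=\|a\|^3$ for all $a\in E$; $N(E)=1$; the spectrum of $L(x,x)$ is contained in $[0,+\infty)$ for all $x\in E$; and the spectrum of $L(x,y)-L(y,x)$ is contained in $i\mathbb{R}$ for all $x,y\in E$. Here spectra are complex spectra, i.e. computed in the complexification of the real Banach algebra of bounded linear operators on $E$. A triple homomorphism is a linear map $T$ with $T(\{a,b,c\})=\{T(a),T(b),T(c)\}$ for all $a,b,c$ (real-linear if one of the two spaces is real); a triple monomorphism is an injective triple homomorphism. *)

(* Defs.v *)
From HB Require Import structures.
From mathcomp Require Import all_boot all_order all_algebra.
From mathcomp Require Import all_classical all_reals all_analysis.
From mathcomp Require Import complex.

Set Implicit Arguments.
Unset Strict Implicit.
Unset Printing Implicit Defensive.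

Import Order.TTheory GRing.Theory Num.Theory.
Import numFieldNormedType.Exports.

Local Open Scope classical_set_scope.
Local Open Scope ring_scope.
Local Open Scope complex_scope.

Inductive scalar_kind := RealScalars | ComplexScalars.

Definition scalar_field (R : realType) (k : scalar_kind) : numFieldType :=
  match k with
  | RealScalars => R : numFieldType
  | ComplexScalars => R[i] : numFieldType
  end.

Definition scalar_conj (R : realType) (k : scalar_kind) :
    scalar_field R k -> scalar_field R k :=
  match k return scalar_field R k -> scalar_field R k with
  | RealScalars => fun a => a
  | ComplexScalars => fun a => conjc (a : R[i])
  end.

Definition scalar_to_complex (R : realType) (k : scalar_kind) :
    scalar_field R k -> R[i] :=
  match k return scalar_field R k -> R[i] with
  | RealScalars => fun a => (a : R)%:C
  | ComplexScalars => fun a => a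
  end.

(* The operator L(x, y) is the partial application [t x y]. [conj] is the
   identity for real triples and complex conjugation for complex ones. *)
Definition normed_jordan_triple (K : numFieldType) (conj : K -> K)
    (E : normedModType K) (t : E -> E -> E -> E) : Prop :=
  (exists x y z, t x y z != 0) /\
  continuous (fun p : E * E * E => t p.1.1 p.1.2 p.2) /\
  (forall x y z, t x y z = t z y x) /\
  (forall y z, linear (fun x => t x y z)) /\
  (forall x y, linear (fun z => t x y z)) /\
  (forall (c : K) x y y' z,
     t x (c *: y + y') z = conj c *: t x y z + t x y' z) /\
  (forall a b x y z,
     t a b (t x y z) - t x y (t a b z) = t (t a b x) y z - t x (t b a y) z).

Definition bounded_operator (K : numFieldType) (E : normedModType K)
    (f : E -> E) : Prop :=
  linear f /\ continuous f.

(* Spectrum in the algebra of bounded operators of a space over its own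
   scalar field. *)
Definition spectrum (K : numFieldType) (E : normedModType K) (f : E -> E) :
    set K :=
  [set l | ~ exists g : E -> E, [/\ bounded_operator g,
     forall x, g (f x - l *: x) = x & forall x, f (g x) - l *: g x = x]].

(* The pair (g, h) stands for g + i h in the complexification of the algebra
   of operators of a real space. *)
Definition cplx_op_mul (R : realType) (E : normedModType R)
    (S S' : (E -> E) * (E -> E)) : (E -> E) * (E -> E) :=
  (fun x => S.1 (S'.1 x) - S.2 (S'.2 x), fun x => S.1 (S'.2 x) + S.2 (S'.1 x)).

Definition cplx_op_one (R : realType) (E : normedModType R) :
    (E -> E) * (E -> E) :=
  (fun x => x, fun=> 0).

(* f - l * 1 *)
Definition cplx_op_shift (R : realType) (E : normedModType R) (f : E -> E)
    (l : R[i]) : (E -> E) * (E -> E) :=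
  (fun x => f x - complex.Re l *: x, fun x => - (complex.Im l *: x)).

Definition complex_spectrum (R : realType) (E : normedModType R)
    (f : E -> E) : set R[i] :=
  [set l | ~ exists S : (E -> E) * (E -> E),
     [/\ bounded_operator S.1, bounded_operator S.2,
         cplx_op_mul S (cplx_op_shift f l) = cplx_op_one E &
         cplx_op_mul (cplx_op_shift f l) S = cplx_op_one E]].

(* For f bounded on a Banach space the series converges in operator norm, so
   that its sum may be computed pointwise. *)
Definition op_exp (K : numFieldType) (E : completeNormedModType K)
    (f : E -> E) (x : E) : E :=
  lim (series (fun n => (n`!%:R)^-1 *: iter n f x) @ \oo).

(* f is hermitian when exp(i s f) is an isometry for every real s. *)
Definition hermitian_operator (R : realType) (E : completeNormedModType R[i])
    (f : E -> E) : Prop :=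
  bounded_operator f /\
  forall (s : R) (x : E), `|op_exp (fun y => (0 +i* s) *: f y) x| = `|x|.

Definition JBstar_triple (R : realType) (E : completeNormedModType R[i])
    (t : E -> E -> E -> E) : Prop :=
  normed_jordan_triple (@conjc R) t /\
  (forall a, hermitian_operator (t a a)) /\
  (forall a, spectrum (t a a) `<=` [set l | 0 <= l]) /\
  (forall a, `|t a a a| = `|a| ^+ 3).

(* N(E). The set is bounded above, because t is continuous, so that this [sup]
   is the supremum. *)
Definition triple_norm (R : realType) (E : normedModType R)
    (t : E -> E -> E -> E) : R :=
  sup [set r | exists x y z,
    [/\ `|x| <= 1, `|y| <= 1, `|z| <= 1 & r = `|t x y z|]].

Definition JstarB_triple (R : realType) (E : completeNormedModType R)
    (t : E -> E -> E -> E) : Prop :=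
  normed_jordan_triple id t /\
  (forall a, `|t a a a| = `|a| ^+ 3) /\
  triple_norm t = 1 /\
  (forall x, complex_spectrum (t x x) `<=` [set l | 0 <= l]) /\
  (forall x y, complex_spectrum (fun z => t x y z - t y x z)
                 `<=` [set l | complex.Re l = 0]).

Definition JBstar_or_JstarB_triple (R : realType) (k : scalar_kind) :
    forall E : completeNormedModType (scalar_field R k),
      (E -> E -> E -> E) -> Prop :=
  match k return
    forall E : completeNormedModType (scalar_field R k), (E -> E -> E -> E) -> Prop
  with
  | RealScalars => @JstarB_triple R
  | ComplexScalars => @JBstar_triple R
  end.

(* The completion of (F, t), determined up to an isometric triple isomorphism
   over F. *)
Definition triple_completion (K : numFieldType) (conj : K -> K)
    (F : normedModType K) (t : F -> F -> F -> F)
    (Fh : completeNormedModType K) (th : Fh -> Fh -> Fh -> Fh)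
    (iota : F -> Fh) : Prop :=
  normed_jordan_triple conj th /\
  linear iota /\
  (forall x, `|iota x| = `|x|) /\
  dense (range iota) /\
  (forall x y z, iota (t x y z) = th (iota x) (iota y) (iota z)).

(* Linearity with respect to the common scalars: complex linearity if both
   spaces are complex, real linearity if at least one of them is real. *)
Definition common_linear (R : realType) (kE kF : scalar_kind)
    (E : lmodType (scalar_field R kE)) (F : lmodType (scalar_field R kF))
    (T : E -> F) : Prop :=
  (forall x y, T (x + y) = T x + T y) /\
  (forall (a : scalar_field R kE) (b : scalar_field R kF) x,
     scalar_to_complex a = scalar_to_complex b -> T (a *: x) = b *: T x).

Definition triple_monomorphism (R : realType) (kE kF : scalar_kind)
    (E : lmodType (scalar_field R kE)) (tE : E -> E -> E -> E)
    (F : lmodType (scalar_field R kF)) (tF : F -> F -> F -> F)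
    (T : E -> F) : Prop :=
  common_linear T /\
  (forall a b c, T (tE a b c) = tF (T a) (T b) (T c)) /\
  injective T.

Definition separating_space (K K' : numFieldType) (E : normedModType K)
    (G : normedModType K') (f : E -> G) : set G :=
  [set z | exists x : nat -> E,
     (x n @[n --> \oo] --> (0 : E)) /\ (f (x n) @[n --> \oo] --> z)].

(* C is the internal (algebraic) direct sum of its subspaces A and B. *)
Definition is_direct_sum (V : zmodType) (C A B : set V) : Prop :=
  C = [set a + b | a in A & b in B] /\ A `&` B = [set 0].

(* Main.v *)
(* It suffices that T is bounded below: then a sequence x_n with T x_n
   convergent is Cauchy in E, so that its limit x splits lim T x_n into T x and
   a limit of T (x_n - x) with x_n - x -> 0, and the sum is direct. Let p be a
   multiple of |T _| with p {x,y,z} <= p x * p y * p z; the claim is |a| <= p a.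

   In E the odd powers of a associate. The identity |{a,a,a}| = |a|^3 and the
   sign of the spectrum of L(a,a) yield a continuous functional calculus
   f |-> f(L(a,a)) a on [0, |a|^2]. If p a < |a|, then after normalising and
   replacing a by a power, |a| = 1 and p a <= 1/10. For a bump f near 1 put
   b = f(L(a,a)) a, which is nonzero. On the ideal of b, for the norm p, each
   L(a,a) - l is bounded below: for |l| >= 1/2 because p contracts L(a,a), for
   |l| < 1/2 because L(a,a) - l has an inverse in the functional calculus.
   An operator without approximate eigenvalues outside a disc has its spectral
   radius in that disc; here all radii are allowed, and L(a,a) is bounded below,
   which is absurd. This form of the spectral radius formula is proved for
   seminorms on polynomials, without completeness or complex integration; it
   also gives the bound of the functional calculus. *)

Require Import Defs.
From HB Require Import structures.
From mathcomp Require Import all_boot all_order all_algebra.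
From mathcomp Require Import all_classical all_reals all_analysis.
From mathcomp Require Import complex.
From mathcomp Require Import ring lra zify.

Set Implicit Arguments.
Unset Strict Implicit.
Unset Printing Implicit Defensive.

Import Order.TTheory GRing.Theory Num.Theory.
Import numFieldNormedType.Exports.
Local Open Scope classical_set_scope.
Local Open Scope ring_scope.
Local Open Scope complex_scope.

(** * Spectral radius and bounds below *)

Notation cabs := ComplexField.Normc.normc.

Section ComplexModulus.
Context {R : realType}.
Implicit Types z w : R[i].

Lemma cabs_ge0 z : 0 <= cabs z.
Proof. by case: z => a b; exact: sqrtr_ge0. Qed.

Lemma cabsM z w : cabs (z * w) = cabs z * cabs w.
Proof. exact: ComplexField.Normc.normcM. Qed.

Lemma cabsN z : cabs (- z) = cabs z.
Proof. exact: normcN. Qed.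

Lemma cabs_real (a : R) : cabs (a%:C) = `|a|.
Proof. by rewrite /= expr0n addr0 sqrtr_sqr. Qed.

Lemma cabsX z n : cabs (z ^+ n) = cabs z ^+ n.
Proof.
elim: n => [|n IH]; first by rewrite !expr0 ComplexField.Normc.normc1.
by rewrite !exprS cabsM IH.
Qed.

Lemma cabs_sqrtC z : cabs (sqrtC z) ^+ 2 = cabs z.
Proof. by rewrite -cabsX sqrtCK. Qed.

Lemma cabs_Re z : `|complex.Re z| <= cabs z.
Proof.
by case: z => a b /=; rewrite -sqrtr_sqr ler_wsqrtr// lerDl sqr_ge0.
Qed.

Lemma cabs_Im z : `|complex.Im z| <= cabs z.
Proof.
by case: z => a b /=; rewrite -sqrtr_sqr ler_wsqrtr// lerDr sqr_ge0.
Qed.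

Lemma cabs_le_coords z : cabs z <= `|complex.Re z| + `|complex.Im z|.
Proof.
rewrite -ler_sqr ?nnegrE ?cabs_ge0 ?addr_ge0 //; case: z => a b /=.
rewrite sqr_sqrtr ?addr_ge0 ?sqr_ge0 // sqrrD !real_normK ?num_real //.
by rewrite -addrA [X in _ <= _ + X]addrC addrA lerDl mulrn_wge0 // mulr_ge0.
Qed.

Lemma cabsB z w : cabs z <= cabs w + cabs (z - w).
Proof. by rewrite -{1}(subrK w z) addrC; exact: le_normcD. Qed.

End ComplexModulus.

Lemma expr_unbounded (R : realType) (u C : R) : 1 < u ->
  exists N, forall n, (N <= n)%N -> C < u ^+ n.
Proof.
move=> u1; have d0 : 0 < u - 1 by rewrite subr_gt0.
have bern n : 1 + n%:R * (u - 1) <= u ^+ n.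
  elim: n => [|n IH]; first by rewrite mul0r addr0.
  rewrite exprS -natr1; apply: le_trans (_ : u * (1 + n%:R * (u - 1)) <= _).
    have : 0 <= n%:R * ((u - 1) * (u - 1)) by rewrite !mulr_ge0 ?ler0n // ltW.
    lra.
  by rewrite ler_pM2l // (lt_trans ltr01).
exists (Num.bound (`|C| / (u - 1))) => n hn.
have hb : `|C| / (u - 1) < (Num.bound (`|C| / (u - 1)))%:R.
  by apply: archi_boundP; rewrite divr_ge0 // ltW.
rewrite ltr_pdivrMr // in hb; apply: le_lt_trans (ler_norm C) (lt_le_trans hb _).
apply: le_trans (_ : n%:R * (u - 1) <= _); first by rewrite ler_pM2r // ler_nat.
by apply: le_trans (bern n); rewrite lerDr.
Qed.

Record poly_seminorm (R : realType) (m : {poly R[i]} -> R) : Prop := {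
  poly_seminormD : forall P Q, m (P + Q) <= m P + m Q;
  poly_seminormZr : forall (t : R) P, m (t%:C *: P) <= `|t| * m P;
  (* the factor 2 allows m to be obtained from a real seminorm by adding its
     values on real and imaginary parts *)
  poly_seminormZ : forall z P, m (z *: P) <= 2 * cabs z * m P }.

Section PolySeminorm.
Variables (R : realType) (m : {poly R[i]} -> R) (hm : poly_seminorm m).
Implicit Types (P Q s : {poly R[i]}) (z w : R[i]).

Lemma poly_seminormN P : m (- P) = m P.
Proof.
have H Q : m (- Q) <= m Q.
  have := poly_seminormZr hm (-1) Q.
  by rewrite normrN1 mul1r (_ : (-1)%:C *: Q = - Q) // rmorphN1 scaleN1r.
by apply/eqP; rewrite eq_le H -{1}(opprK P) H.
Qed.

Lemma poly_seminormB P Q : m (P - Q) <= m P + m Q.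
Proof. by rewrite -(poly_seminormN Q); exact: poly_seminormD. Qed.

Lemma poly_seminorm_ge0 P : 0 <= m P.
Proof.
have h0 : m 0 <= 0.
  by have := poly_seminormZr hm 0 0; rewrite scaler0 normr0 mul0r.
have h1 := poly_seminormD hm 0 0; rewrite addr0 in h1.
have := poly_seminormB P P; rewrite subrr => h2; lra.
Qed.

Lemma poly_seminorm_triangle P Q : m P <= m Q + m (P - Q).
Proof. by rewrite -{1}(subrK Q P) addrC; exact: poly_seminormD. Qed.

Lemma poly_seminorm_half P : m P <= (m ((1 + 1) * P)) / 2.
Proof.
have e : (2^-1)%:C *: ((1 + 1) * P) = P.
  have -> : (1 + 1) * P = (2 : R)%:C *: P.
    by rewrite mulrDl mul1r -mulr2n (rmorph_nat (real_complex R)) scaler_nat.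
  by rewrite scalerA -rmorphM mulVf ?pnatr_eq0 // scale1r.
have := poly_seminormZr hm 2^-1 ((1 + 1) * P).
by rewrite e ger0_norm ?invr_ge0 // mulrC.
Qed.

Lemma poly_seminormZ_ge0 (t : R) P : 0 <= t -> m (t%:C *: P) = t * m P.
Proof.
rewrite le_eqVlt => /orP[/eqP <-|t0].
  rewrite mul0r scale0r; apply/eqP; rewrite eq_le poly_seminorm_ge0 andbT.
  by have := poly_seminormZr hm 0 0; rewrite scaler0 normr0 mul0r.
apply/eqP; rewrite eq_le; apply/andP; split.
  by rewrite -{2}(gtr0_norm t0); exact: poly_seminormZr.
rewrite -ler_pdivlMl // -(@gtr0_norm _ t^-1) ?invr_gt0 //.
apply: le_trans (poly_seminormZr hm _ _).
by rewrite scalerA -rmorphM mulVf ?gt_eqF // scale1r.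
Qed.

End PolySeminorm.

Section Growth.
Variables (R : realType) (m : {poly R[i]} -> R) (hm : poly_seminorm m).
Variables (K r0 : R) (r0_gt0 : 0 < r0) (K_gt0 : 0 < K).
Hypothesis mX : forall P, m ('X * P) <= K * m P.
Hypothesis m_below : forall l, r0 <= cabs l ->
  exists2 c, 0 < c & forall P, c * m P <= m (('X - l%:P) * P).
Implicit Types (P Q s : {poly R[i]}) (z w : R[i]).

Let m_ge0 := poly_seminorm_ge0 hm.
Let pw (z : R[i]) (N : nat) : {poly R[i]} := z *: 'X^N.

(** The inversion l = 1/z turns the outside of the disc into the compact disc |z| <= 1/r0, with z =
    0 in place of infinity, through X - 1/z = - (1/z) (1 - z X). *)
Lemma below_disc_pointwise z : cabs z * r0 <= 1 ->
  exists2 c, 0 < c & forall P, c * m P <= m ((1 - pw z 1) * P).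
Proof.
move=> hz; have [->|z0] := eqVneq z 0.
  by exists 1 => // P; rewrite /pw scale0r subr0 !mul1r.
have az0 : 0 < cabs z.
  rewrite lt_def cabs_ge0 andbT; apply: contraNneq z0.
  by move/ComplexField.Normc.eq0_normc => ->.
have [|c c0 hc] := m_below (l := z^-1).
  by rewrite ComplexField.Normc.normcV -[_^-1]mul1r ler_pdivlMr // mulrC.
exists (c / (2 * (cabs z)^-1)); first by rewrite divr_gt0 // mulr_gt0 // invr_gt0.
move=> P; rewrite mulrAC ler_pdivrMr ?mulr_gt0 ?invr_gt0 //.
apply: le_trans (hc P) _.
have -> : ('X - (z^-1)%:P) * P = (- z^-1) *: ((1 - pw z 1) * P).
  rewrite /pw expr1 scalerAl; congr (_ * _).
  by rewrite scalerBr scalerA mulNr mulVf // scaleN1r opprK addrC scaleNr alg_polyC.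
apply: le_trans (poly_seminormZ hm _ _) _.
by rewrite cabsN ComplexField.Normc.normcV mulrC.
Qed.


(** Compactness of the disc: a lower bound c0 at z0 leaves c0 / 2 at nearby z, because 1 - z X
    varies by at most 2 |z - z0| K. The covering is taken over a square, on which the claim is void
    off the disc. *)
Lemma below_disc_uniform : exists2 c, 0 < c &
  forall z, cabs z * r0 <= 1 -> forall P, c * m P <= m ((1 - pw z 1) * P).
Proof.
pose M := r0^-1; have M0 : 0 < M by rewrite invr_gt0.
pose D : set (R * R) := `[- M, M] `*` `[- M, M].
have cD : compact D by apply: compact_setX; exact: segment_compact.
pose Pr (c : R) (w : R * R) := cabs (w.1 +i* w.2) * r0 <= 1 ->
  forall P, c * m P <= m ((1 - pw (w.1 +i* w.2) 1) * P).
have /compact_near_coveringP := cD.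
move=> /(_ _ (0 : R)^'+ Pr (at_right_proper_filter _)) near_c.
have near_ball (x : R * R) d : 0 < d ->
    \forall w \near x, cabs ((w.1 +i* w.2) - (x.1 +i* x.2)) < d.
  move=> d0; near=> w.
  apply: le_lt_trans (cabs_le_coords _) _ => /=.
  have : ball x (d / 2) w by near: w; apply: nbhsx_ballx; rewrite divr_gt0.
  move=> [/=]; rewrite /ball /= => h1 h2.
  rewrite distrC in h1; rewrite distrC in h2; lra.
have {}near_c : \forall c \near 0^'+, D `<=` Pr c.
  apply: near_c => x _; case: (lerP (cabs (x.1 +i* x.2) * r0) 1) => hx.
    have [c0 c00 hc0] := below_disc_pointwise hx.
    have d0 : 0 < c0 / (4 * K) by rewrite divr_gt0 // mulr_gt0.
    have nc : \forall c \near (0 : R)^'+, c <= c0 / 2.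
      by apply: nbhs_right_le; rewrite divr_gt0.
    (* The radius is chosen so that 2 (c0 / (4 K)) K = c0 / 2. *)
    exists ([set w | cabs (w.1 +i* w.2 - (x.1 +i* x.2)) < c0 / (4 * K)],
            [set c | c <= c0 / 2]).
      by split => //; exact: near_ball.
    move=> [w c] [/= hw hc] _ P.
    set z := w.1 +i* w.2 in hw *; set z0 := x.1 +i* x.2 in hw hc0.
    have e : (1 - pw z0 1) * P - (1 - pw z 1) * P = (z - z0) *: ('X * P).
      rewrite -mulrBl scalerAl; congr (_ * _).
      by rewrite /pw expr1 scalerBl opprB addrC addrA subrK.
    have h2 := poly_seminorm_triangle hm ((1 - pw z0 1) * P) ((1 - pw z 1) * P).
    rewrite e in h2; have h3 := poly_seminormZ hm (z - z0) ('X * P).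
    have h4 : m ('X * P) <= K * m P by [].
    have h5 : 2 * cabs (z - z0) * m ('X * P) <= 2 * (c0 / (4 * K)) * (K * m P).
      by apply: ler_pM => //; [rewrite mulr_ge0 ?cabs_ge0 | rewrite ler_pM2l // ltW].
    have e2 : 2 * (c0 / (4 * K)) * (K * m P) = c0 / 2 * m P.
      by field; rewrite gt_eqF.
    have h6 : c * m P <= c0 / 2 * m P by rewrite ler_wpM2r.
    have := hc0 P; lra.
  (* Outside the closed disc a whole neighbourhood misses it, so that [Pr] holds there vacuously. *)
  have d0 : 0 < cabs (x.1 +i* x.2) - r0^-1.
    by rewrite subr_gt0 -[_^-1]mul1r ltr_pdivrMr.
  exists ([set w | cabs (w.1 +i* w.2 - (x.1 +i* x.2)) < cabs (x.1 +i* x.2) - r0^-1],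
          setT).
    by split; [exact: near_ball | exact: filterT].
  move=> [w c] [hw _] hz.
  exfalso; rewrite -ler_pdivlMr // mul1r in hz.
  have := cabsB (x.1 +i* x.2) (w.1 +i* w.2).
  have hw2 : cabs (- (w.1 +i* w.2 - (x.1 +i* x.2))) < cabs (x.1 +i* x.2) - r0^-1.
    by rewrite cabsN.
  rewrite opprB in hw2; lra.
have [c [c0 hc]] : exists c, 0 < c /\ D `<=` Pr c.
  near (0:R)^'+ => c; exists c; split => //; near: c => //.
exists c => // z hz P; case: z hz => x y hz; apply: (hc (x, y) _) => //.
have hM : cabs (x +i* y) <= M by rewrite /M -[_^-1]mul1r ler_pdivlMr.
have := le_trans (cabs_Re _) hM; have := le_trans (cabs_Im _) hM.
by rewrite !ler_norml /= => h1 h2; split; rewrite /= in_itv.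
Unshelve. all: by end_near. Qed.

Section Doubling.
Variables (c : R) (c_gt0 : 0 < c).
Hypothesis m_disc : forall z, cabs z * r0 <= 1 ->
  forall P, c * m P <= m ((1 - pw z 1) * P).

Let pwN z N : pw (- z) N = - pw z N. Proof. exact: scaleNr. Qed.

Let pwM z w N M : pw z N * pw w M = pw (z * w) (N + M).
Proof. by rewrite /pw -scalerAl -scalerAr scalerA -exprD. Qed.

Let sqrt_disc z N : cabs z * r0 ^+ (N + N) <= 1 -> cabs (sqrtC z) * r0 ^+ N <= 1.
Proof.
move=> hz; rewrite -(@expr_le1 _ 2) //; last by rewrite mulr_ge0 ?cabs_ge0 ?exprn_ge0 ?ltW.
by rewrite exprMn cabs_sqrtC -exprM muln2 -addnn.
Qed.

(* Equicontinuity in the radius is preserved by doubling of the exponent, through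
   2 (x + y) = (1 + x) (1 + y) - (1 - x) (1 - y). *)
Lemma radius_equicontinuity (e : R) (t : R[i]) : 0 <= e ->
  2 * cabs (t - 1) * K <= e * c ^+ 2 * r0 ->
  forall j z, cabs z * r0 ^+ (2 ^ j) <= 1 ->
    cabs (t ^+ (2 ^ j) * z) * r0 ^+ (2 ^ j) <= 1 ->
  forall P, m ((pw (t ^+ (2 ^ j) * z) (2 ^ j) - pw z (2 ^ j)) * P) <=
    e * m ((1 - pw z (2 ^ j)) * (1 - pw (t ^+ (2 ^ j) * z) (2 ^ j)) * P).
Proof.
move=> e0 ht; elim=> [|j IH] z hz hy P.
  (* Base case: the left side is bounded through [mX], the right side from below by two uses of
     [m_disc], which account for the factor c ^ 2 in the hypothesis. *)
  rewrite expn0 !expr1 in hz hy *.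
  have -> : (pw (t * z) 1 - pw z 1) * P = ((t - 1) * z) *: ('X * P).
    by rewrite scalerAl /pw expr1 -scalerBl mulrBl mul1r.
  apply: le_trans (poly_seminormZ hm _ _) _; rewrite cabsM.
  have h1 := m_disc hy P; have h2 := m_disc hz ((1 - pw (t * z) 1) * P).
  rewrite mulrA in h2.
  have h3 := mX P.
  have h4 : c * (c * m P) <= m ((1 - pw z 1) * (1 - pw (t * z) 1) * P).
    by apply: le_trans h2; rewrite ler_pM2l.
  have h5 : 2 * (cabs (t - 1) * cabs z) * m ('X * P) <=
      2 * (cabs (t - 1) * cabs z) * (K * m P).
    by rewrite ler_wpM2l // mulr_ge0 // mulr_ge0 ?cabs_ge0.
  have h6 : 2 * (cabs (t - 1) * cabs z) * (K * m P) <= e * c ^+ 2 * m P.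
    have -> : 2 * (cabs (t - 1) * cabs z) * (K * m P) =
      2 * cabs (t - 1) * K * (cabs z * m P) by ring.
    apply: le_trans (_ : e * c ^+ 2 * r0 * (cabs z * m P) <= _).
      by rewrite ler_wpM2r // mulr_ge0 ?cabs_ge0.
    have -> : e * c ^+ 2 * r0 * (cabs z * m P) = e * c ^+ 2 * (cabs z * r0 * m P) by ring.
    by apply: ler_wpM2l; [rewrite mulr_ge0 ?sqr_ge0 | apply: ler_piMl].
  apply: le_trans h5 (le_trans h6 _).
  by rewrite -mulrA ler_wpM2l // expr2 -mulrA.
(* For the doubling let u^2 = z, x = u X^N, y = t^N u X^N. The induction hypothesis is used at u on
   (1 + x)(1 + y) P and at -u on (1 - x)(1 - y) P. Both right sides become e m ((1 - x^2)(1 - y^2)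
   P), and the left sides together bound m (2 (y^2 - x^2) P). *)
have eN : (2 ^ j.+1 = 2 ^ j + 2 ^ j)%N by rewrite expnS mul2n addnn.
rewrite eN in hz hy *; set N := (2 ^ j)%N in IH hz hy *.
have hu := sqrt_disc hz; set u := sqrtC z in hu.
have zu : z = u * u by rewrite -expr2 sqrtCK.
have hv : cabs (t ^+ N * u) * r0 ^+ N <= 1.
  rewrite -(@expr_le1 _ 2) //; last by rewrite mulr_ge0 ?cabs_ge0 ?exprn_ge0 ?ltW.
  move: hy; rewrite zu !exprD !cabsM => hy; apply: le_trans hy.
  by rewrite le_eqVlt; apply/orP; left; apply/eqP; ring.
have hu' : cabs (- u) * r0 ^+ N <= 1 by rewrite cabsN.
have hv' : cabs (t ^+ N * - u) * r0 ^+ N <= 1 by rewrite mulrN cabsN.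
have -> : pw z (N + N) = pw u N * pw u N by rewrite pwM -zu.
have -> : pw (t ^+ (N + N) * z) (N + N) = pw (t ^+ N * u) N * pw (t ^+ N * u) N.
  by rewrite pwM zu exprD; congr pw; ring.
set x := pw u N; set y := pw (t ^+ N * u) N.
have h1 := IH _ hu hv ((1 + x) * (1 + y) * P).
have h2 := IH _ hu' hv' ((1 - x) * (1 - y) * P).
rewrite mulrN !pwN !opprK -/x -/y in h2; rewrite -/x -/y in h1.
have h3 := poly_seminorm_half hm ((y * y - x * x) * P).
have h4 := poly_seminormD hm ((y - x) * ((1 + x) * (1 + y) * P))
  ((- y + x) * ((1 - x) * (1 - y) * P)).
have e1 : (y - x) * ((1 + x) * (1 + y) * P) + (- y + x) * ((1 - x) * (1 - y) * P) =
  (1 + 1) * ((y * y - x * x) * P) by ring.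
have e2 : (1 - x) * (1 - y) * ((1 + x) * (1 + y) * P) =
  (1 - x * x) * (1 - y * y) * P by ring.
have e3 : (1 + x) * (1 + y) * ((1 - x) * (1 - y) * P) =
  (1 - x * x) * (1 - y * y) * P by ring.
rewrite e1 in h4; rewrite e2 in h1; rewrite e3 in h2; lra.
Qed.

End Doubling.


(** Since m ((1 - x)(1 - y) P) <= 4/3 (m P + m (y P)), one has m (y P) <= m P / 3 + (m P + m (y P))
    / 6, which solves to 3/5. *)
Lemma perturbed_contraction x y P : (forall Q, m (x * Q) <= 3^-1 * m Q) ->
  m ((y - x) * P) <= 8^-1 * m ((1 - x) * (1 - y) * P) -> m (y * P) <= 3 / 5 * m P.
Proof.
move=> hx h1; have h2 := hx P; have h3 := hx ((1 - y) * P).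
have h4 := poly_seminormB hm ((1 - y) * P) (x * ((1 - y) * P)).
have e4 : (1 - y) * P - x * ((1 - y) * P) = (1 - x) * (1 - y) * P by ring.
have h5 := poly_seminormB hm P (y * P).
have e5 : P - y * P = (1 - y) * P by ring.
have h6 := poly_seminormD hm (x * P) ((y - x) * P).
have e6 : x * P + (y - x) * P = y * P by ring.
rewrite e4 in h4; rewrite e5 in h5; rewrite e6 in h6; lra.
Qed.

(** Continuation in the radius. [G t] says that some power (t X)^(2^j) contracts by 1/3. It holds
    for small t, and equicontinuity carries it from t to tau t with a fixed tau > 1 as long as t <=
    1/r. So it reaches t = 1/r, which controls one power X^N and hence all of them. *)
Lemma growth_bound r : r0 < r ->
  exists2 C, 0 <= C & forall k P, m ('X^k * P) <= C * r ^+ k * m P.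
Proof.
move=> r0r; have r_gt0 : 0 < r by exact: lt_trans r0r.
have [c c_gt0 m_disc] := below_disc_uniform.
pose G (t : R) := exists j, forall P, t ^+ (2 ^ j) * m ('X^(2 ^ j) * P) <= 3^-1 * m P.
have G_mono t t' : 0 <= t' -> t' <= t -> G t -> G t'.
  move=> t'0 tt' [j hj]; exists j => P; apply: le_trans (hj P).
  by rewrite ler_wpM2r // lerXn2r // nnegrE // (le_trans t'0).
have pwE (t : R) N P : 0 <= t -> m (pw (t%:C ^+ N) N * P) = t ^+ N * m ('X^N * P).
  by move=> t0; rewrite -scalerAl -rmorphXn poly_seminormZ_ge0 // exprn_ge0.
pose e : R := 8^-1.
(* The first term gives tau <= r / r0, which keeps tau t r0 <= 1; the second is the hypothesis of
   [radius_equicontinuity] for e = 1/8. *)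
pose d := Num.min ((r - r0) / r0) (e * c ^+ 2 * r0 / (2 * K)).
have d_gt0 : 0 < d.
  rewrite lt_min !divr_gt0 ?subr_gt0 ?mulr_gt0 // ?invr_gt0 //; exact: exprn_gt0.
pose tau := 1 + d.
have G_step t : 0 < t -> t <= r^-1 -> G t -> G (tau * t).
  move=> t0 tr [j hj]; set N := (2 ^ j)%N in hj.
  have tau1 : 1 < tau by rewrite ltrDl.
  have tau_t0 : 0 < tau * t by rewrite mulr_gt0 // (lt_trans _ tau1).
  have tau_le : tau <= r / r0.
    have -> : r / r0 = 1 + (r - r0) / r0 by field; rewrite gt_eqF.
    by rewrite lerD2l /d ge_min lexx.
  have htr0 : tau * t * r0 <= 1.
    have -> : 1 = r / r0 * r^-1 * r0 by field; rewrite !gt_eqF.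
    by rewrite ler_pM2r // ler_pM // ltW // (lt_trans _ tau1).
  pose z : R[i] := t%:C ^+ N.
  have eyz : tau%:C ^+ N * z = (tau * t)%:C ^+ N by rewrite -exprMn -rmorphM.
  have hz : cabs z * r0 ^+ N <= 1.
    have tr0 : t * r0 <= 1.
      apply: le_trans (_ : r^-1 * r <= 1); last by rewrite mulVf ?gt_eqF.
      by rewrite ler_pM // ltW.
    by rewrite cabsX cabs_real gtr0_norm // -exprMn exprn_ile1 // mulr_ge0 ?ltW.
  have hy : cabs (tau%:C ^+ N * z) * r0 ^+ N <= 1.
    by rewrite eyz cabsX cabs_real gtr0_norm // -exprMn exprn_ile1 // mulr_ge0 ?ltW.
  have ht : 2 * cabs (tau%:C - 1) * K <= e * c ^+ 2 * r0.
    have -> : cabs (tau%:C - 1) = d.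
      by rewrite -(rmorph1 (real_complex R)) -rmorphB cabs_real addrC addKr gtr0_norm.
    have : d <= e * c ^+ 2 * r0 / (2 * K) by rewrite ge_min lexx orbT.
    by rewrite ler_pdivlMr ?mulr_gt0 // mulrCA mulrA.
  have e0 : 0 <= e by rewrite invr_ge0.
  have eq := radius_equicontinuity c_gt0 m_disc e0 ht hz hy.
  rewrite eyz -/N in eq.
  have hx P : m (pw z N * P) <= 3^-1 * m P by rewrite (pwE _ _ _ (ltW t0)).
  have hyP P : (tau * t) ^+ N * m ('X^N * P) <= 3 / 5 * m P.
    by rewrite -(pwE _ _ _ (ltW tau_t0)); exact: perturbed_contraction hx (eq P).
  (* [perturbed_contraction] leaves the factor 3/5, whose fourth power 81/625 is below 1/3: hence
     two more doublings. *)
  exists j.+2 => P; rewrite !expnS -/N mulnA mulnC exprM.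
  have -> : 'X^(N * (2 * 2)) * P = 'X^N * ('X^N * ('X^N * ('X^N * P))).
    by rewrite exprM; ring.
  have aN0 : 0 <= (tau * t) ^+ N by rewrite exprn_ge0 // ltW.
  set A := (tau * t) ^+ N in hyP aN0 *.
  have h1 := hyP P; have h2 := hyP ('X^N * P); have h3 := hyP ('X^N * ('X^N * P)).
  have h4 := hyP ('X^N * ('X^N * ('X^N * P))).
  have h3' := ler_wpM2l aN0 h4; have h2' := ler_wpM2l aN0 h3'.
  have h1' := ler_wpM2l aN0 h2'.
  have h5 := ler_wpM2l aN0 h3; have h6 := ler_wpM2l aN0 h5.
  have h7 := ler_wpM2l aN0 h2; have := m_ge0 P.
  have -> : A ^+ (2 * 2) = A * (A * (A * A)) by ring.
  lra.
have G_r : G r^-1.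
  (* At t0 one has t0 K <= 1/3, so j = 0 works; then multiply by tau repeatedly, truncating at
     1/r. *)
  pose t0 := Num.min (3 * K)^-1 r^-1.
  have t0_gt0 : 0 < t0 by rewrite lt_min !invr_gt0 r_gt0 mulr_gt0.
  have tau_gt0 : 0 < tau by rewrite addr_gt0.
  have Gn n : G (Num.min (t0 * tau ^+ n) r^-1).
    elim: n => [|n IH].
      exists 0%N => P; rewrite expn0 !expr1 mulr1.
      apply: le_trans (_ : (3 * K)^-1 * m ('X * P) <= _).
        by rewrite ler_wpM2r // /t0 ge_min ge_min lexx.
      rewrite invfM -mulrA ler_pM2l ?invr_gt0 // ler_pdivrMl //; exact: mX.
    have [h|h] := leP (t0 * tau ^+ n) r^-1; rewrite ?(min_l h) ?(min_r (ltW h)) in IH.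
      apply: G_mono (G_step _ _ h IH); first by rewrite le_min invr_ge0 !ltW // mulr_gt0 // exprn_gt0.
        by rewrite ge_min exprS mulrCA lexx.
      by rewrite mulr_gt0 // exprn_gt0.
    rewrite min_r // exprS mulrCA; apply: le_trans (ltW h) _.
    by rewrite ler_peMl ?lerDl ?ltW // mulr_gt0 // exprn_gt0.
  have tau1 : 1 < tau by rewrite ltrDl.
  have [n /(_ n (leqnn n)) hn] := expr_unbounded (t0 * r)^-1 tau1.
  have := Gn n; rewrite min_r //.
  apply: le_trans (_ : t0 * (t0 * r)^-1 <= _).
    by rewrite invfM mulrA divff ?gt_eqF // mul1r.
  by rewrite ler_pM2l // ltW.
have [j hj] := G_r; set N := (2 ^ j)%N in hj.
have N0 : (0 < N)%N by rewrite expn_gt0.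
have hN P : m ('X^N * P) <= r ^+ N * m P.
  have := hj P; rewrite exprVn ler_pdivrMl ?exprn_gt0 // => h; apply: le_trans h _.
  by rewrite ler_pM2l ?exprn_gt0 // ler_piMl // invf_le1 ?ler1n.
pose K' := Num.max K r; have K'0 : 0 < K' by rewrite lt_max K_gt0.
have hK' i P : m ('X^i * P) <= K' ^+ i * m P.
  elim: i => [|i IH]; first by rewrite !expr0 !mul1r.
  rewrite !exprS -!mulrA; apply: le_trans (mX _) _.
  by apply: ler_pM => //; [exact: ltW | rewrite /K' le_max lexx].
have hNq q P : m ('X^(q * N) * P) <= r ^+ (q * N) * m P.
  elim: q => [|q IH]; first by rewrite mul0n !expr0 !mul1r.
  rewrite mulSn !exprD -!mulrA; apply: le_trans (hN _) _.
  by rewrite ler_pM2l ?exprn_gt0.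
(* Division with remainder k = q N + s: the multiple of N costs r^(q N), and s < N costs at most the
   extra factor (K' / r)^N, as K' >= r. *)
exists ((K' / r) ^+ N) => [|k P]; first by rewrite exprn_ge0 // divr_ge0 // ltW.
rewrite {1}(divn_eq k N) exprD -mulrA; apply: le_trans (hNq _ _) _.
apply: le_trans (_ : r ^+ (k %/ N * N) * (K' ^+ (k %% N) * m P) <= _).
  by rewrite ler_pM2l ?exprn_gt0.
have -> : r ^+ k = r ^+ (k %/ N * N) * r ^+ (k %% N) by rewrite -exprD -divn_eq.
rewrite mulrA ler_wpM2r // mulrCA ler_pM2l ?exprn_gt0 //.
rewrite -ler_pdivrMr ?exprn_gt0 // -expr_div_n ler_weXn2l //.
  by rewrite ler_pdivlMr // mul1r /K' le_max lexx orbT.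
by rewrite ltnW // ltn_mod.
Qed.

End Growth.

(** * Uniform limits of polynomials on [0, 1] *)

Section PolyApprox.
Variable R : realType.
Implicit Types (f g : R -> R) (q : {poly R}).

(** By Weierstrass's theorem these are the functions continuous on [0, 1]; here closure under the
    required operations is proved directly. *)
Definition poly_approx f := forall e, 0 < e ->
  exists q : {poly R}, forall x, 0 <= x <= 1 -> `|f x - q.[x]| <= e.

Lemma poly_approx_horner q : poly_approx (fun x => q.[x]).
Proof. by move=> e e0; exists q => x _; rewrite subrr normr0 ltW. Qed.

Lemma poly_approx_eq f g : (forall x, 0 <= x <= 1 -> f x = g x) ->
  poly_approx f -> poly_approx g.
Proof. by move=> fg hf e /hf[q hq]; exists q => x hx; rewrite -fg // hq. Qed.

Lemma poly_approx_cst (c : R) : poly_approx (fun=> c).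
Proof.
by apply: poly_approx_eq (poly_approx_horner c%:P) => x _; rewrite hornerC.
Qed.

Lemma poly_approx_id : poly_approx id.
Proof. by apply: poly_approx_eq (poly_approx_horner 'X) => x _; rewrite hornerX. Qed.

Lemma poly_approxD f g : poly_approx f -> poly_approx g ->
  poly_approx (fun x => f x + g x).
Proof.
move=> hf hg e e0; have e20 : 0 < e / 2 by rewrite divr_gt0.
have [p hp] := hf _ e20; have [q hq] := hg _ e20.
exists (p + q) => x hx; rewrite hornerD opprD addrACA [e]splitr.
by apply: le_trans (ler_normD _ _) _; rewrite lerD ?hp ?hq.
Qed.

Lemma poly_approx_bounded f : poly_approx f ->
  exists2 M, 1 <= M & forall x, 0 <= x <= 1 -> `|f x| <= M.
Proof.
move=> /(_ 1 ltr01)[q hq].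
exists (1 + \sum_(i < size q) `|q`_i|) => [|x hx].
  by rewrite lerDl sumr_ge0.
have := hq x hx; have : `|q.[x]| <= \sum_(i < size q) `|q`_i|.
  rewrite horner_coef; apply: le_trans (ler_norm_sum _ _ _) _.
  apply: ler_sum => i _; rewrite normrM normrX ler_piMr // exprn_ile1 //.
  by case/andP: hx => x0 x1; rewrite ger0_norm.
have := ler_normD (f x - q.[x]) q.[x]; rewrite subrK => *; lra.
Qed.

Lemma poly_approxM f g : poly_approx f -> poly_approx g ->
  poly_approx (fun x => f x * g x).
Proof.
move=> hf hg e e0; have [M M1 hM] := poly_approx_bounded hg.
have M0 : 0 < M by exact: lt_le_trans M1.
have [p hp] := hf (e / 2 / M) (divr_gt0 (divr_gt0 e0 (ltr0n R 2)) M0).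
have [N N1 hN] := poly_approx_bounded (poly_approx_horner p).
have N0 : 0 < N by exact: lt_le_trans N1.
have [q hq] := hg (e / 2 / N) (divr_gt0 (divr_gt0 e0 (ltr0n R 2)) N0).
exists (p * q) => x hx; rewrite hornerM.
have -> : f x * g x - p.[x] * q.[x] = (f x - p.[x]) * g x + p.[x] * (g x - q.[x]) by ring.
apply: le_trans (ler_normD _ _) _; rewrite [e]splitr !normrM lerD //.
  by rewrite -[leRHS](divfK (lt0r_neq0 M0)) ler_pM ?hp ?hM.
by rewrite -[leRHS](divfK (lt0r_neq0 N0)) mulrC ler_pM ?hq ?hN.
Qed.

Lemma poly_approx_lim f : (forall e, 0 < e ->
    exists2 g, poly_approx g & forall x, 0 <= x <= 1 -> `|f x - g x| <= e) ->
  poly_approx f.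
Proof.
move=> hf e e0; have e20 : 0 < e / 2 by rewrite divr_gt0.
have [g hg fg] := hf _ e20; have [q hq] := hg _ e20.
exists q => x hx; rewrite [e]splitr -(subrK (g x) (f x)) -addrA.
by apply: le_trans (ler_normD _ _) _; rewrite lerD ?fg ?hq.
Qed.

Lemma poly_approxX f n : poly_approx f -> poly_approx (fun x => f x ^+ n).
Proof.
move=> hf; elim: n => [|n IH]; first exact: poly_approx_cst.
by apply: poly_approx_eq (poly_approxM hf IH) => x _; rewrite exprS.
Qed.

Lemma poly_approxZ (c : R) f : poly_approx f -> poly_approx (fun x => c * f x).
Proof. exact/poly_approxM/poly_approx_cst. Qed.

Lemma poly_approxB f g : poly_approx f -> poly_approx g ->
  poly_approx (fun x => f x - g x).
Proof.
move=> hf hg; apply: poly_approx_eq (poly_approxD hf (poly_approxZ (-1) hg)) => x _.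
by rewrite mulN1r.
Qed.

(* 1/f = (1/M) \sum_k (1 - f/M)^k for an upper bound M of f *)
Lemma poly_approxV f (d : R) : 0 < d -> (forall x, 0 <= x <= 1 -> d <= f x) ->
  poly_approx f -> poly_approx (fun x => (f x)^-1).
Proof.
move=> d0 fd hf; have [M M1 hM] := poly_approx_bounded hf.
have M0 : 0 < M by exact: lt_le_trans M1.
have f0 x : 0 <= x <= 1 -> 0 < f x by move=> /fd; exact: lt_le_trans.
have fM x : 0 <= x <= 1 -> f x <= M by move=> hx; exact: le_trans (ler_norm _) (hM x hx).
have h0 : 0 <= (0 : R) <= 1 by rewrite lexx ler01.
have dM : d <= M by exact: le_trans (fd _ h0) (fM _ h0).
pose w x := 1 - M^-1 * f x; pose a := 1 - M^-1 * d.
have a0 : 0 <= a by rewrite subr_ge0 ler_pdivrMl // mulr1.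
have a1 : a < 1 by rewrite ltrBlDr ltrDl mulr_gt0 ?invr_gt0.
have hw : poly_approx w.
  exact: poly_approxB (poly_approx_cst 1) (poly_approxZ _ hf).
apply: poly_approx_lim => e e0.
(* On [0, 1] one has 0 <= w <= a < 1, so the remainder w^n / f of the series is at most a^n / d <=
   e. *)
have [n hn] : exists n, a ^+ n <= e * d.
  have /cvgrPdist_le/(_ _ (mulr_gt0 e0 d0)) : a ^+ n @[n --> \oo] --> (0 : R).
    by apply: cvg_expr; rewrite ger0_norm.
  by case=> n _ /(_ n (leqnn n)); rewrite /= sub0r normrN ger0_norm ?exprn_ge0 //; exists n.
have [S hS fS] : exists2 S, poly_approx S & forall x, f x * S x = 1 - w x ^+ n.
  elim: n {hn} => [|n [S hS fS]].
    by exists (fun=> 0) => [|x]; [exact: poly_approx_cst | rewrite mulr0 subrr].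
  exists (fun x => S x + M^-1 * w x ^+ n).
    exact: poly_approxD hS (poly_approxZ _ (poly_approxX n hw)).
  by move=> x; rewrite mulrDr fS exprS /w; ring.
exists S => // x hx; have fx0 := f0 x hx.
have -> : (f x)^-1 - S x = w x ^+ n / f x.
  have -> : S x = f x * S x / f x by rewrite mulrAC divff ?gt_eqF // mul1r.
  by rewrite fS; field; rewrite gt_eqF.
have w0 : 0 <= w x by rewrite subr_ge0 ler_pdivrMl // mulr1 fM.
rewrite ger0_norm ?ler_pdivrMr //; last by rewrite divr_ge0 ?exprn_ge0 // ltW.
apply: le_trans (_ : a ^+ n <= _).
  by rewrite lerXn2r // /w /a lerB // ler_pM2l ?invr_gt0 // fd.
by apply: le_trans hn _; rewrite ler_pM2l // fd.
Qed.

(* Visser's iteration u <- u + (f^2 - u^2)/2 for the square root of f^2 *)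
Lemma poly_approx_abs f : poly_approx f -> poly_approx (fun x => `|f x|).
Proof.
move=> hf0; have [M M1 hM] := poly_approx_bounded hf0.
have M0 : 0 < M by exact: lt_le_trans M1.
pose g x := M^-1 * f x.
have hg : poly_approx g by exact: poly_approxZ.
have g1 x : 0 <= x <= 1 -> `|g x| <= 1.
  by move=> hx; rewrite normrM gtr0_norm ?invr_gt0 // ler_pdivrMl // mulr1 hM.
suff h : poly_approx (fun x => `|g x|).
  apply: poly_approx_eq (poly_approxZ M h) => x _.
  by rewrite normrM gtr0_norm ?invr_gt0 // mulrA divff ?gt_eqF // mul1r.
apply: poly_approx_lim => e e0.
(* After n steps the error v = |g| - u satisfies (n + 1) v <= 2: the next error is v (1 - (|g| + u)
   / 2) <= v (1 - v / 2), and k v <= 2 gives (k + 1) v (1 - v / 2) <= 2 - v^2 / 2. *)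
have [u hu gu] : exists2 u, poly_approx u & forall x, 0 <= x <= 1 ->
    0 <= u x <= `|g x| /\ (Num.bound (2 / e)).+1%:R * (`|g x| - u x) <= 2.
  elim: (Num.bound _) => [|n [u hu gu]].
    exists (fun=> 0) => [|x hx]; first exact: poly_approx_cst.
    by rewrite lexx subr0 mul1r normr_ge0; split=> //; have := g1 x hx; lra.
  exists (fun x => u x + 2^-1 * (g x ^+ 2 - u x ^+ 2)).
    exact: poly_approxD hu (poly_approxZ _ (poly_approxB (poly_approxX 2 hg) (poly_approxX 2 hu))).
  move=> x hx; have [/andP[u0 us] un] := gu x hx; have s1 := g1 x hx.
  rewrite -(real_normK (num_real (g x))); set s := `|g x| in us un s1 *.
  set v := s - u x in un.
  have v0 : 0 <= v by rewrite subr_ge0.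
  have vs : v <= s by rewrite gerBl.
  have eu : u x = s - v by rewrite /v; ring.
  have hprod : 0 <= v * (s + u x) by rewrite mulr_ge0 // addr_ge0 // (le_trans u0).
  have e1 : u x + 2^-1 * (s ^+ 2 - u x ^+ 2) = u x + 2^-1 * (v * (s + u x)).
    by rewrite /v; ring.
  have hp2 : v * (s + u x) <= v * 2.
    by rewrite ler_wpM2l //; lra.
  rewrite e1; split; first by apply/andP; split; rewrite /v in hp2 *; lra.
  have e2 : s - (u x + 2^-1 * (v * (s + u x))) = v - 2^-1 * (v * (s + u x)).
    by rewrite /v; ring.
  rewrite e2 -natr1; set k : R := n.+1%:R in un *.
  have k0 : 0 <= k by rewrite ler0n.
  have hvv : v * v <= v * (s + u x) by rewrite ler_wpM2l //; lra.
  have h3 : (k + 1) * (v - 2^-1 * (v * (s + u x))) <= (k + 1) * (v - 2^-1 * (v * v)).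
    by rewrite ler_wpM2l ?addr_ge0 //; lra.
  apply: le_trans h3 _.
  have h4 : k * v * (1 - 2^-1 * v) <= 2 * (1 - 2^-1 * v) by rewrite ler_wpM2r //; lra.
  have := mulr_ge0 v0 v0; nra.
exists u => // x hx; have [/andP[u0 us] un] := gu x hx.
rewrite ger0_norm ?subr_ge0 // -(ler_pM2l (ltr0Sn R (Num.bound (2 / e)))).
apply: le_trans un _.
have : 2 / e < (Num.bound (2 / e))%:R by apply: archi_boundP; rewrite divr_ge0 // ltW.
rewrite ltr_pdivrMr // => h; apply: le_trans (ltW h) _.
by rewrite ler_pM2r // ler_nat.
Qed.

Lemma poly_approx_max f g : poly_approx f -> poly_approx g ->
  poly_approx (fun x => Num.max (f x) (g x)).
Proof.
move=> hf hg.
have h := poly_approxZ 2^-1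
  (poly_approxD (poly_approxD hf hg) (poly_approx_abs (poly_approxB hf hg))).
apply: poly_approx_eq h => x _; rewrite maxr_absE; lra.
Qed.

End PolyApprox.

(** * Complexified seminorms and spectral mapping *)

Section Complexification.
Variable R : realType.
Implicit Types (p q : {poly R}) (P Q : {poly R[i]}) (l : R[i]).

Local Notation toC := (map_poly (real_complex R)).

Definition rePoly P : {poly R} := \poly_(i < size P) complex.Re P`_i.
Definition imPoly P : {poly R} := \poly_(i < size P) complex.Im P`_i.

Lemma coef_rePoly P i : (rePoly P)`_i = complex.Re P`_i.
Proof. by rewrite coef_poly; case: ltnP => // h; rewrite nth_default. Qed.

Lemma coef_imPoly P i : (imPoly P)`_i = complex.Im P`_i.
Proof. by rewrite coef_poly; case: ltnP => // h; rewrite nth_default. Qed.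

Lemma rePolyD P Q : rePoly (P + Q) = rePoly P + rePoly Q.
Proof.
apply/polyP => i; rewrite coefD !coef_rePoly coefD.
by case: P`_i => a b; case: Q`_i.
Qed.

Lemma imPolyD P Q : imPoly (P + Q) = imPoly P + imPoly Q.
Proof.
apply/polyP => i; rewrite coefD !coef_imPoly coefD.
by case: P`_i => a b; case: Q`_i.
Qed.

Lemma rePolyZ l P :
  rePoly (l *: P) = complex.Re l *: rePoly P - complex.Im l *: imPoly P.
Proof.
apply/polyP => i; rewrite coefB !coefZ !coef_rePoly coef_imPoly coefZ.
by case: l => a b; case: P`_i.
Qed.

Lemma imPolyZ l P :
  imPoly (l *: P) = complex.Re l *: imPoly P + complex.Im l *: rePoly P.
Proof.
apply/polyP => i; rewrite coefD !coefZ !coef_imPoly coef_rePoly coefZ.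
by case: l => a b; case: P`_i.
Qed.

Lemma rePolyM p P : rePoly (toC p * P) = p * rePoly P.
Proof.
apply/polyP => i; rewrite coef_rePoly !coefM.
rewrite (big_morph (@complex.Re R) (id1 := 0) (op1 := +%R)) //; last by case=> a b [].
apply: eq_bigr => j _; rewrite coef_map coef_rePoly /=.
by case: P`_(_) => a b /=; rewrite mul0r subr0.
Qed.

Lemma imPolyM p P : imPoly (toC p * P) = p * imPoly P.
Proof.
apply/polyP => i; rewrite coef_imPoly !coefM.
rewrite (big_morph (@complex.Im R) (id1 := 0) (op1 := +%R)) //; last by case=> a b [].
apply: eq_bigr => j _; rewrite coef_map coef_imPoly /=.
by case: P`_(_) => a b /=; rewrite mul0r addr0.
Qed.

Lemma rePoly_real p : rePoly (toC p) = p.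
Proof. by apply/polyP => i; rewrite coef_rePoly coef_map. Qed.

Lemma imPoly_real p : imPoly (toC p) = 0.
Proof. by apply/polyP => i; rewrite coef_imPoly coef_map coef0. Qed.

Variable n : {poly R} -> R.
Hypothesis nD : forall p q, n (p + q) <= n p + n q.
Hypothesis nZ : forall a p, n (a *: p) = `|a| * n p.

Definition complexified P := n (rePoly P) + n (imPoly P).

Lemma real_seminorm0 : n 0 = 0.
Proof. by rewrite -(scale0r 0) nZ normr0 mul0r. Qed.

Lemma real_seminorm_ge0 p : 0 <= n p.
Proof.
have := nD p (-1 *: p); rewrite nZ normrN1 mul1r scaleN1r subrr real_seminorm0 => h; lra.
Qed.

Lemma complexified_seminorm : poly_seminorm complexified.
Proof.
have nB p q : n (p - q) <= n p + n q.
  by apply: le_trans (nD _ _) _; rewrite -scaleN1r nZ normrN1 mul1r.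
split=> [P Q|a P|l P]; rewrite /complexified.
- have := nD (rePoly P) (rePoly Q); have := nD (imPoly P) (imPoly Q).
  rewrite rePolyD imPolyD; lra.
- by rewrite rePolyZ imPolyZ /= !scale0r subr0 addr0 !nZ mulrDr.
rewrite rePolyZ imPolyZ; set A := rePoly P; set B := imPoly P.
have h1 := nB (complex.Re l *: A) (complex.Im l *: B).
have h2 := nD (complex.Re l *: B) (complex.Im l *: A).
rewrite !nZ in h1 h2.
have h3 := ler_wpM2r (real_seminorm_ge0 A) (cabs_Re l); have h4 := ler_wpM2r (real_seminorm_ge0 B) (cabs_Re l).
have h5 := ler_wpM2r (real_seminorm_ge0 A) (cabs_Im l); have h6 := ler_wpM2r (real_seminorm_ge0 B) (cabs_Im l).
lra.
Qed.

Lemma complexified_real p : complexified (toC p) = n p.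
Proof. by rewrite /complexified rePoly_real imPoly_real real_seminorm0 addr0. Qed.

Lemma complexifiedM_le p c : (forall q, n (p * q) <= c * n q) ->
  forall P, complexified (toC p * P) <= c * complexified P.
Proof. by move=> h P; rewrite /complexified rePolyM imPolyM mulrDr lerD. Qed.

Lemma complexifiedM_ge p c : (forall q, c * n q <= n (p * q)) ->
  forall P, c * complexified P <= complexified (toC p * P).
Proof. by move=> h P; rewrite /complexified rePolyM imPolyM mulrDr lerD. Qed.

(* (X - l) times its conjugate *)
Definition conj_quad l : {poly R} :=
  ('X - (complex.Re l)%:P) ^+ 2 + ((complex.Im l) ^+ 2)%:P.

Lemma conj_quadE l : toC (conj_quad l) = ('X - (conjc l)%:P) * ('X - l%:P).
Proof.
rewrite rmorphD /= rmorphXn /= rmorphB /= map_polyX !map_polyC /=.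
case: l => a b /=; apply/polyP => i.
have -> : ('X - (a -i* b)%:P) * ('X - (a +i* b)%:P) =
  'X ^+ 2 - ((a -i* b) + (a +i* b))%:P * 'X + ((a -i* b) * (a +i* b))%:P.
  by rewrite polyCD polyCM; ring.
have -> : ('X - (a%:C)%:P) ^+ 2 + ((b ^+ 2)%:C)%:P =
  'X ^+ 2 - (a%:C + a%:C)%:P * 'X + (a%:C * a%:C + (b ^+ 2)%:C)%:P.
  by rewrite !polyCD polyCM; ring.
congr ((_ - _%:P * _ + _%:P)`_i); first by simpc; rewrite addNr.
by simpc; congr (_ +i* _); ring.
Qed.

Variables (K : R) (K_gt0 : 0 < K).
Hypothesis nX : forall p, n ('X * p) <= K * n p.

Lemma complexifiedX P : complexified ('X * P) <= K * complexified P.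
Proof. by have := complexifiedM_le nX P; rewrite map_polyX. Qed.

(** Multiplication by X - conj l costs at most the factor K + 2 |l|, so a lower bound for the real
    polynomial (X - conj l)(X - l) yields one for X - l. *)
Lemma complexified_below l :
  (exists2 c, 0 < c & forall p, c * n p <= n (conj_quad l * p)) ->
  exists2 c, 0 < c & forall P, c * complexified P <= complexified (('X - l%:P) * P).
Proof.
move=> [c c0 hc]; have hs := complexified_seminorm.
have A0 : 0 < K + 2 * cabs l by rewrite ltr_wpDr // mulr_ge0 // cabs_ge0.
exists (c / (K + 2 * cabs l)) => [|P]; first by rewrite divr_gt0.
rewrite mulrAC ler_pdivrMr //; apply: le_trans (complexifiedM_ge hc P) _.
rewrite conj_quadE -mulrA; set Q := (_ - l%:P) * P.
have := poly_seminormB hs ('X * Q) (conjc l *: Q).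
have := poly_seminormZ hs (conjc l) Q; have := complexifiedX Q.
have -> : cabs (conjc l) = cabs l by case: (l) => a b /=; rewrite sqrrN.
rewrite -mul_polyC -mulrBl; lra.
Qed.

End Complexification.

Section SpectralGrowth.
Variables (R : realType) (m : {poly R[i]} -> R) (hm : poly_seminorm m).
Variables (K : R) (K_gt0 : 0 < K).
Hypothesis mX : forall P, m ('X * P) <= K * m P.
Hypothesis m_below : forall l, ~ (exists2 x : R, 0 <= x <= 1 & l = x%:C) ->
  exists2 c, 0 < c & forall P, c * m P <= m (('X - l%:P) * P).
Implicit Types (P Q H : {poly R[i]}).

(** H splits into linear factors over the complex numbers. None of its roots lies in [0, 1], and the
    lower bounds of the factors multiply. *)
Lemma below_mul H : H != 0 ->
  (forall x : R, 0 <= x <= 1 -> H.[x%:C] != 0) ->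
  exists2 c, 0 < c & forall P, c * m P <= m (H * P).
Proof.
move=> H0; have [s ->] := closed_field_poly_normal H.
move: H0; rewrite -lead_coef_eq0; set a := lead_coef H => a0 hroot.
have {hroot} hs x : x \in s -> ~ (exists2 y : R, 0 <= y <= 1 & x = y%:C).
  move=> xs [y y01 exy]; have /negP := hroot y y01; apply.
  rewrite hornerZ mulf_eq0 -/(root _ _) root_prod_XsubC -exy xs orbT //.
have [c c0 hc] : exists2 c, 0 < c & forall P,
    c * m P <= m (\prod_(z <- s) ('X - z%:P) * P).
  elim: s hs => [|x s IH] hs.
    by exists 1 => // P; rewrite big_nil !mul1r.
  have [|c c0 hc] := IH; first by move=> y ys; apply: hs; rewrite inE ys orbT.
  have [|d d0 hd] := m_below (l := x); first by apply: hs; rewrite mem_head.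
  exists (d * c) => [|P]; first by rewrite mulr_gt0.
  rewrite big_cons -!mulrA; apply: le_trans (hd _).
  by rewrite ler_pM2l.
have ca : 0 < 2 * cabs a^-1.
  rewrite mulr_gt0 // lt_def cabs_ge0 andbT.
  by apply: contraNneq a0 => /ComplexField.Normc.eq0_normc/eqP; rewrite invr_eq0.
exists (c / (2 * cabs a^-1)) => [|P]; first by rewrite divr_gt0.
rewrite mulrAC ler_pdivrMr //; apply: le_trans (hc P) _.
set D := \prod_(z <- s) _.
have := poly_seminormZ hm a^-1 (a *: D * P).
have -> : a^-1 *: (a *: D * P) = D * P.
  by rewrite -scalerAl scalerA mulVf // scale1r.
by move/le_trans; apply; rewrite [leRHS]mulrC.
Qed.

Lemma mul_bounded H : exists2 c, 0 < c & forall P, m (H * P) <= c * m P.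
Proof.
elim/poly_ind: H => [|H a [c c0 hc]].
  exists 1 => // P; rewrite mul0r -(scale0r 0) mul1r.
  apply: le_trans (poly_seminorm_ge0 hm P).
  by have := poly_seminormZr hm 0 0; rewrite rmorph0 normr0 mul0r.
exists (c * K + 2 * cabs a) => [|P].
  by rewrite ltr_wpDr ?mulr_gt0 // mulr_ge0 // cabs_ge0.
rewrite mulrDl -mulrA mul_polyC; apply: le_trans (poly_seminormD hm _ _) _.
rewrite mulrDl lerD ?(poly_seminormZ hm) // (le_trans (hc _)) //.
by rewrite -mulrA ler_pM2l.
Qed.

(** Spectral mapping: for |l| > rho the polynomial H - l has no zero on [0, 1], so multiplication by
    it is bounded below. [growth_bound] then applies to the seminorm sending P to m ((P o H) q), on
    which X acts as H. *)
Lemma spectral_growth H q rho r : 0 < rho -> rho < r ->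
  (forall x : R, 0 <= x <= 1 -> cabs (H.[x%:C]) <= rho) ->
  exists2 C, 0 <= C & forall k, m (H ^+ k * q) <= C * r ^+ k.
Proof.
move=> rho0 rho_r hH.
(* [growth_bound] takes lower bounds on a closed set |l| >= rho', where |l| = rho must be excluded,
   and gives growth rates beyond rho': hence the midpoint. *)
pose rho' := (rho + r) / 2.
have rho'r : rho' < r by rewrite /rho'; lra.
have rho'0 : 0 < rho' by rewrite /rho'; lra.
have rho_rho' : rho < rho' by rewrite /rho'; lra.
pose m' P := m ((P \Po H) * q).
have hm' : poly_seminorm m'.
  split=> [P Q|a P|z P]; rewrite /m'.
  - by rewrite comp_polyD mulrDl; exact: poly_seminormD.
  - by rewrite comp_polyZ -scalerAl; exact: poly_seminormZr.
  - by rewrite comp_polyZ -scalerAl; exact: poly_seminormZ.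
have [K' K'0 hK'] := mul_bounded H.
have m'X P : m' ('X * P) <= K' * m' P.
  by rewrite /m' comp_polyM comp_polyX -mulrA.
have [l hl|C C0 hC] := growth_bound hm' rho'0 K'0 m'X _ rho'r.
  have HlP x : 0 <= x <= 1 -> (H - l%:P).[x%:C] != 0.
    move=> hx; rewrite hornerD hornerN hornerC subr_eq0; apply: contraTneq hl => <-.
    by rewrite -ltNge (le_lt_trans (hH x hx)).
  have [|c c0 hc] := below_mul _ HlP.
    apply: contraTneq isT => e; have := HlP 0; rewrite lexx ler01 e horner0 eqxx.
    by move=> /(_ isT).
  exists c => // P; rewrite /m' comp_polyM -mulrA.
  by rewrite comp_polyB comp_polyX comp_polyC.
exists (C * m q) => [|k]; first by rewrite mulr_ge0 // poly_seminorm_ge0.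
have := hC k 1; rewrite /m' mulr1 comp_Xn_poly -(polyC1 R[i]) comp_polyC polyC1 mul1r.
by rewrite mulrAC.
Qed.

End SpectralGrowth.

(** * Power associativity *)

(** Scalars are real here: a complex triple is regarded as a real one, whose conjugate linear middle
    variable becomes linear. *)
Record jordan_triple (R : realType) (V : lmodType R) (t : V -> V -> V -> V) : Prop := {
  triple_sym : forall x y z, t x y z = t z y x;
  triple_linl : forall y z, linear (fun x => t x y z);
  triple_linm : forall x z, linear (fun y => t x y z);
  triple_jordan : forall a b x y z,
    t a b (t x y z) - t x y (t a b z) = t (t a b x) y z - t x (t b a y) z }.

Section LinearPredicate.
Variables (R : realType) (U V : lmodType R) (f : U -> V) (hf : linear f).

Lemma linear_add x y : f (x + y) = f x + f y.
Proof. by have := hf 1 x y; rewrite !scale1r. Qed.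

Lemma linear_0 : f 0 = 0.
Proof. by have := hf (-1) 0 0; rewrite scaler0 add0r scaleN1r addNr. Qed.

Lemma linear_scale a x : f (a *: x) = a *: f x.
Proof. by have := hf a x 0; rewrite linear_0 !addr0. Qed.

Lemma linear_sub x y : f (x - y) = f x - f y.
Proof. by rewrite -[- y]scaleN1r addrC hf scaleN1r addrC. Qed.

End LinearPredicate.

Lemma poly_linear_ext (R : realType) (V : lmodType R) (f g : {poly R} -> V) :
  linear f -> linear g -> (forall i, f 'X^i = g 'X^i) -> f =1 g.
Proof.
move=> hf hg fg p; rewrite -[p]coefK poly_def.
elim/big_rec: _ => [|i q _ IH]; first by rewrite !linear_0.
by rewrite hf hg fg IH.
Qed.

Section JordanTriple.
Variables (R : realType) (V : lmodType R) (t : V -> V -> V -> V).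
Hypothesis ht : jordan_triple t.
Implicit Types (x y z : V) (p q : {poly R}).

Lemma triple_linr x y : linear (t x y).
Proof. by move=> c z z'; rewrite !(triple_sym ht x); exact: triple_linl. Qed.

Variable a : V.
Let L := t a a.

Definition tpow k := iter k (t a a) a.

Lemma tpowS k : tpow k.+1 = L (tpow k). Proof. by []. Qed.

(* [L, L(P_i, P_j)] computed with either operator in the first place: the two
   expressions of this bracket are opposite up to the factor n + 1. *)
Lemma tpow_operator n : exists2 M : V -> V,
  (forall i j, (i + j)%N = n -> t (tpow i) (tpow j) =1 M) &
  forall x, L (M x) = M (L x).
Proof.
elim: n => [|n [M hM ML]].
  by exists L => // i j /eqP; rewrite addn_eq0 => /andP[/eqP -> /eqP ->].
have br N i j x : (forall i j, (i + j)%N = n -> t (tpow i) (tpow j) =1 N) ->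
    (i + j)%N = n -> L (N x) - N (L x) =
    t (tpow i.+1) (tpow j) x - t (tpow i) (tpow j.+1) x.
  by move=> hN e; rewrite -!(hN _ _ e); exact: triple_jordan.
have step i j x : (i + j)%N = n -> t (tpow i.+1) (tpow j) x = t (tpow i) (tpow j.+1) x.
  by move=> e; apply/eqP; rewrite -subr_eq0 -(br M i j x hM e) ML subrr.
pose M' := t (tpow n.+1) a.
have hM' i j : (i + j)%N = n.+1 -> t (tpow i) (tpow j) =1 M'.
  elim: j i => [|j IH] i; first by rewrite addn0 => ->.
  by rewrite addnS => -[e] x; rewrite -step // IH // addSn e.
exists M' => // x; pose D := L (M' x) - M' (L x).
have tel i j : (i + j)%N = n.+2 ->
    t (tpow i) (tpow j) x = t (tpow n.+2) a x - j%:R *: D.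
  elim: j i => [|j IH] i; first by rewrite addn0 scale0r subr0 => ->.
  rewrite addnS => -[e].
  have eD : D = t (tpow i.+1) (tpow j) x - t (tpow i) (tpow j.+1) x.
    by rewrite /D -!(hM' _ _ e); exact: triple_jordan.
  have := IH i.+1; rewrite addSn e => /(_ erefl) e2.
  rewrite -natr1 scalerDl scale1r opprD addrA -e2 eD; apply/esym.
  by rewrite opprB addrC subrK.
have eD : - D = t (tpow n.+2) a x - t a (tpow n.+2) x.
  have := triple_jordan ht (tpow n.+1) a a a x; rewrite /D opprB => ->.
  have -> : t (tpow n.+1) a a = tpow n.+2 by rewrite (triple_sym ht).
  by have -> : t a (tpow n.+1) a = tpow n.+2
    by rewrite (hM' 0%N n.+1) // /M' (triple_sym ht).
have := tel 0%N n.+2 erefl; rewrite /= -/L => e3.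
have : n.+3%:R *: D = 0.
  rewrite -natr1 scalerDl scale1r -[X in _ + X]opprK eD.
  by rewrite [t a _ _]e3 opprB addrCA addrA subrK addrN.
move=> /eqP; rewrite scaler_eq0 pnatr_eq0 /= /D subr_eq0 => /eqP //.
Qed.

(** L(P_i, P_j) depends only on i + j and commutes with L, which reduces the claim to j = k = 0. *)
Lemma triple_tpow i j k : t (tpow i) (tpow j) (tpow k) = tpow (i + j + k).+1.
Proof.
have [M hM ML] := tpow_operator (i + j)%N.
rewrite (hM i j) //; elim: k => [|k IH]; last by rewrite tpowS -ML IH addnS.
rewrite addn0 -(hM (i + j)%N 0%N) ?addn0 // (triple_sym ht) tpowS //.
Qed.

(** The polynomial calculus p(L(a,a)) x. *)
Definition act p x := \sum_(i < size p) p`_i *: iter i L x.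

Lemma act_widen n p x : (size p <= n)%N ->
  act p x = \sum_(i < n) p`_i *: iter i L x.
Proof.
move=> h; rewrite /act (big_ord_widen n (fun i => p`_i *: iter i L x) h).
rewrite big_mkcond; apply: eq_bigr => i _; case: ltnP => // hi.
by rewrite nth_default // scale0r.
Qed.

Lemma act_linear_poly x : linear (act^~ x).
Proof.
move=> c p q; pose n := maxn (size (c *: p + q)) (maxn (size p) (size q)).
rewrite !(act_widen (n := n)) ?leq_maxl ?leq_max ?leqnn ?orbT //.
rewrite scaler_sumr -big_split; apply: eq_bigr => i _ /=.
by rewrite coefD coefZ scalerDl scalerA.
Qed.

Lemma actXn i x : act 'X^i x = iter i L x.
Proof.
rewrite /act size_polyXn big_ord_recr /= coefXn eqxx scale1r.
rewrite big1 ?add0r // => j _.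
by rewrite coefXn ltn_eqF // scale0r.
Qed.

Lemma act1 x : act 1 x = x. Proof. exact: actXn 0%N x. Qed.

Lemma actX x : act 'X x = L x. Proof. exact: actXn 1%N x. Qed.

Lemma act_linear p : linear (act p).
Proof.
have iterL i : linear (fun x => iter i L x).
  by elim: i => [|i IH] c x y //=; rewrite IH; exact: triple_linr.
move=> c x y; rewrite /act scaler_sumr -big_split; apply: eq_bigr => i _ /=.
by rewrite iterL scalerDr !scalerA mulrC.
Qed.

Lemma actM p q x : act (p * q) x = act p (act q x).
Proof.
move: q; apply: poly_linear_ext => [c q q'|c q q'|j].
- by rewrite mulrDr -scalerAr act_linear_poly.
- by rewrite act_linear_poly act_linear.
move: p; apply: poly_linear_ext => [c q q'|c q q'|i].
- by rewrite mulrDl -scalerAl act_linear_poly.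
- exact: act_linear_poly.
by rewrite -exprD !actXn iterD.
Qed.

Lemma act_tpow i : act 'X^i a = tpow i. Proof. exact: actXn. Qed.

(** Linearity in each variable reduces this to monomials, where it is [triple_tpow]; the factor 'X
    is the successor in the exponent there. *)
Lemma triple_act p q r :
  t (act p a) (act q a) (act r a) = act ('X * p * q * r) a.
Proof.
move: p; apply: poly_linear_ext => [c p p'|c p p'|i].
- by rewrite act_linear_poly (triple_linl ht).
- by rewrite mulrDr !mulrDl -scalerAr -!scalerAl act_linear_poly.
move: q; apply: poly_linear_ext => [c p p'|c p p'|j].
- by rewrite act_linear_poly (triple_linm ht).
- by rewrite mulrDr !mulrDl -scalerAr -!scalerAl act_linear_poly.
move: r; apply: poly_linear_ext => [c p p'|c p p'|k].
- by rewrite act_linear_poly (triple_linr _ _).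
- by rewrite mulrDr -scalerAr act_linear_poly.
by rewrite -exprS -!exprD !act_tpow triple_tpow !addSn.
Qed.

End JordanTriple.

(** * Functional calculus *)

(** A norm is a bare function, because two norms on one space are to be compared: that of E and a
    multiple of |T x|. *)
Record vnorm (R : realType) (V : lmodType R) (p : V -> R) : Prop := {
  vnormD : forall x y, p (x + y) <= p x + p y;
  vnormZ : forall c x, p (c *: x) = `|c| * p x;
  vnorm_eq0 : forall x, p x = 0 -> x = 0 }.

Section VNorm.
Variables (R : realType) (V : lmodType R) (p : V -> R) (hp : vnorm p).

Lemma vnorm0 : p 0 = 0.
Proof. by rewrite -(scale0r 0) (vnormZ hp) normr0 mul0r. Qed.

Lemma vnormN x : p (- x) = p x.
Proof. by rewrite -scaleN1r (vnormZ hp) normrN1 mul1r. Qed.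

Lemma vnormB x y : p (x - y) <= p x + p y.
Proof. by rewrite -(vnormN y); exact: vnormD. Qed.

Lemma vnorm_distC x y : p (x - y) = p (y - x).
Proof. by rewrite -vnormN opprB. Qed.

Lemma vnorm_ge0 x : 0 <= p x.
Proof. have := vnormB x x; rewrite subrr vnorm0 => h; lra. Qed.

Lemma vnorm_gt0 x : x != 0 -> 0 < p x.
Proof.
move=> x0; rewrite lt_def vnorm_ge0 andbT.
by apply: contraNneq x0 => /(vnorm_eq0 hp) ->.
Qed.

Lemma vnorm_triangle x y : p x <= p y + p (x - y).
Proof. by rewrite -{1}(subrK y x) addrC; exact: vnormD. Qed.

End VNorm.

(** The common real form of both classes of triples. [cubic_below] stands for the inclusion of the
    spectrum of L(a,a) in [0, +oo). *)
Record cubic_triple (R : realType) (V : lmodType R) (t : V -> V -> V -> V)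
    (nrm : V -> R) (K : R) : Prop := {
  cubic_jordan : jordan_triple t;
  cubic_vnorm : vnorm nrm;
  cubic_bound : forall x y z, nrm (t x y z) <= K * nrm x * nrm y * nrm z;
  cubic_cube : forall a, nrm (t a a a) = nrm a ^+ 3;
  (* conj_quad l evaluated at L(a,a) is (L(a,a) - l) (L(a,a) - conj l) *)
  cubic_below : forall a (l : R[i]), ~ (0 <= l) ->
    exists2 c, 0 < c & forall x, c * nrm x <= nrm (act t a (conj_quad l) x);
  cubic_complete : forall u : nat -> V,
    (forall e, 0 < e -> exists N, forall i j, (N <= i)%N -> (N <= j)%N ->
      nrm (u i - u j) <= e) ->
    exists l, forall e, 0 < e -> exists N, forall i, (N <= i)%N -> nrm (u i - l) <= e }.

Section CubicTriple.
Variables (R : realType) (V : lmodType R) (t : V -> V -> V -> V) (nrm : V -> R).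
Variables (K : R) (K_gt0 : 0 < K) (hE : cubic_triple t nrm K).
Implicit Types (x y z : V) (p q : {poly R}).

Let ht := cubic_jordan hE.
Let hn := cubic_vnorm hE.
Let nrm_ge0 := vnorm_ge0 hn.
Local Notation toC := (map_poly (real_complex R)).

(* tpow a k is the power a^(2 k + 1); these exponents give a^(3 ^ j) *)
Fixpoint cube_exp j := if j is j'.+1 then (3 * cube_exp j').+1 else 0%N.

Lemma cube_expE j : (3 ^ j = (cube_exp j).*2.+1)%N.
Proof. by elim: j => //= j IH; rewrite expnS IH -!muln2; lia. Qed.

Lemma leq_cube_exp j : (j <= cube_exp j)%N.
Proof. by elim: j => //= j IH; lia. Qed.

Lemma tpow_cube_exp a j : nrm (tpow t a (cube_exp j)) = nrm a ^+ (3 ^ j).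
Proof.
elim: j => [|j IH]; first by rewrite expr1.
rewrite (_ : cube_exp j.+1 = (3 * cube_exp j).+1) //.
have -> : tpow t a (3 * cube_exp j).+1 =
    t (tpow t a (cube_exp j)) (tpow t a (cube_exp j)) (tpow t a (cube_exp j)).
  by rewrite (triple_tpow ht); congr (tpow t a _); lia.
by rewrite (cubic_cube hE) IH -exprM expnSr.
Qed.

Section UnitElement.
Variables (a : V) (a1 : nrm a = 1).

Let n p := nrm (act t a p a).
Let m := complexified n.

Let nD p q : n (p + q) <= n p + n q.
Proof. by rewrite /n (linear_add (act_linear_poly _ _ _)) vnormD. Qed.

Let nZ c p : n (c *: p) = `|c| * n p.
Proof. by rewrite /n (linear_scale (act_linear_poly _ _ _)) (vnormZ hn). Qed.

Let nX p : n ('X * p) <= K * n p.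
Proof.
rewrite /n (actM ht) actX; apply: le_trans (cubic_bound hE _ _ _) _.
by rewrite a1 !mulr1.
Qed.

Let hm : poly_seminorm m. Proof. exact: complexified_seminorm. Qed.
Let mX P : m ('X * P) <= K * m P. Proof. exact: complexifiedX. Qed.

(** The left side is the norm of {a^(3^j), a, p(L(a,a)) a}, and a^(3^j) has norm 1 by the cube
    identity. The bound is therefore uniform in j. *)
Let n_power j p : n ('X^((cube_exp j).+1) * p) <= K * n p.
Proof.
have := triple_act ht a 'X^(cube_exp j) 1 p.
rewrite act_tpow act1 mulr1 -exprS {1}/n => <-.
apply: le_trans (cubic_bound hE _ _ _) _.
by rewrite tpow_cube_exp a1 expr1n !mulr1.
Qed.

(** X^N - x^N is a multiple S (X - x). For N from [n_power] with x^N > 2 K it is bounded below by K,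
    and multiplication by S is bounded. *)
Let m_below_gt1 (x : R) : 1 < x ->
  exists2 c, 0 < c & forall P, c * m P <= m (('X - (x%:C)%:P) * P).
Proof.
move=> x1; have x0 : 0 < x by exact: lt_trans x1.
have [j hj] := expr_unbounded (2 * K) x1.
set N := (cube_exp j).+1; have {}hj : 2 * K < x ^+ N.
  by apply: hj; rewrite leqW // leq_cube_exp.
set S : {poly R[i]} := \sum_(i < N) 'X ^+ (N.-1 - i) * (x%:C)%:P ^+ i.
have [c c0 hc] := mul_bounded hm K_gt0 mX S.
exists (K / c) => [|P]; first by rewrite divr_gt0.
rewrite mulrAC ler_pdivrMr // [leRHS]mulrC; apply: le_trans (hc _).
have e : S * (('X - (x%:C)%:P) * P) = 'X^N * P - ((x ^+ N)%:C) *: P.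
  rewrite mulrA [S * _]mulrC -subrXX mulrBl -polyC_exp -rmorphXn mul_polyC //.
have hXN : m ('X^N * P) <= K * m P.
  have := complexifiedM_le (@n_power j) P.
  by rewrite rmorphXn /= map_polyX.
have := poly_seminorm_triangle hm ((x ^+ N)%:C *: P) ('X^N * P).
rewrite -opprB (poly_seminormN hm) -e (poly_seminormZ_ge0 hm) ?exprn_ge0 ?(ltW x0) //.
have := ler_wpM2r (poly_seminorm_ge0 hm P) (ltW hj).
by rewrite e; set A := m (_ - _); set B := m P in hXN *; lra.
Qed.

Let m_below l : ~ (exists2 x : R, 0 <= x <= 1 & l = x%:C) ->
  exists2 c, 0 < c & forall P, c * m P <= m (('X - l%:P) * P).
Proof.
move=> hl; have [l0|l0] := boolP (0 <= l).
  have el : l = (complex.Re l)%:C by rewrite RRe_real // ger0_real.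
  rewrite el; apply: m_below_gt1; rewrite ltNge; apply/negP => l1; apply: hl.
  by exists (complex.Re l); rewrite ?l1 ?andbT // -ler0c -el.
apply: (complexified_below nD nZ K_gt0 nX).
have [c c0 hc] := cubic_below hE a (elimN idP l0).
by exists c => // p; rewrite /n (actM ht).
Qed.

(** The powers of b = q(L(a,a)) a are (h^k q)(L(a,a)) a with h = X q^2, and |h| <= M^2 on [0, 1]. By
    [spectral_growth] they grow no faster than r^k for any r > M^2, while |b^(3^j)| = |b|^(3^j) with
    3^j = 2 k + 1. Were |b| > M, some r between M^2 and |b|^2 would contradict this. *)
Lemma nrm_act_le q M : 0 < M -> (forall x : R, 0 <= x <= 1 -> `|q.[x]| <= M) ->
  nrm (act t a q a) <= M.
Proof.
move=> M0 qM; set b := act t a q a; set h := 'X * q ^+ 2.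
have powb k : tpow t b k = act t a (h ^+ k * q) a.
  elim: k => [|k IH]; first by rewrite expr0 mul1r.
  by rewrite tpowS IH /b (triple_act ht); congr (act t a _ a); rewrite exprS; set hk := h ^+ k; rewrite /h; ring.
rewrite leNgt; apply/negP => Mb.
pose r := (M ^+ 2 + nrm b ^+ 2) / 2.
have Mb2 : M ^+ 2 < nrm b ^+ 2 by rewrite ltrXn2r // ltW.
have M20 : 0 < M ^+ 2 by rewrite exprn_gt0.
have Mr : M ^+ 2 < r by rewrite /r; lra.
have rb : r < nrm b ^+ 2 by rewrite /r; lra.
have r0 : 0 < r by exact: lt_trans Mr.
have [x hx|C C0 hC] := spectral_growth hm K_gt0 mX m_below (toC q) M20 Mr (H := toC h).
  rewrite horner_map cabs_real hornerM hornerX horner_exp normrM normrX.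
  have /andP[x0 x1] := hx; rewrite (ger0_norm x0) -[leRHS]mul1r.
  by rewrite ler_pM // ?exprn_ge0 // lerXn2r ?nnegrE ?(le_trans _ (qM x hx)) // qM.
have b0 : 0 < nrm b by exact: lt_trans Mb.
have {}hC j : nrm b ^+ (3 ^ j) <= C * r ^+ (cube_exp j).
  have := hC (cube_exp j); set k := cube_exp j.
  have -> : toC h ^+ k * toC q = toC (h ^+ k * q) by rewrite [RHS]rmorphM /= rmorphXn.
  by rewrite /m (complexified_real nZ) /n -powb /k tpow_cube_exp.
have u1 : 1 < nrm b ^+ 2 / r by rewrite ltr_pdivlMr // mul1r.
have [N hN] := expr_unbounded (C / nrm b) u1.
have := hC N; have := hN _ (leq_cube_exp N).
rewrite expr_div_n ltr_pdivlMr ?exprn_gt0 // -mulrA [_^-1 * _]mulrC mulrA.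
rewrite ltr_pdivrMr // -exprM -exprSr mul2n -cube_expE => h1 h2.
by have := lt_le_trans h1 h2; rewrite ltxx.
Qed.

End UnitElement.

End CubicTriple.

Section FunctionalCalculus.
Variables (R : realType) (V : lmodType R) (t : V -> V -> V -> V) (nrm : V -> R).
Variables (K : R) (K_gt0 : 0 < K) (hE : cubic_triple t nrm K).
Variables (a : V) (a1 : nrm a = 1).
Implicit Types (x y z : V) (q s : {poly R}) (f g h w : R -> R).

Let ht := cubic_jordan hE.
Let hn := cubic_vnorm hE.
Let nrm_ge0 := vnorm_ge0 hn.

(* x = f(L(a,a)) a *)
Definition represents f x := forall e, 0 < e -> exists q,
  (forall u, 0 <= u <= 1 -> `|f u - q.[u]| <= e) /\ nrm (x - act t a q a) <= e.

Lemma represents_poly_approx f x : represents f x -> poly_approx f.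
Proof. by move=> hf e /hf[q [hq _]]; exists q. Qed.

Lemma represents_poly q : represents (fun u => q.[u]) (act t a q a).
Proof.
move=> e e0; exists q; split=> [u _|]; first by rewrite subrr normr0 ltW.
by rewrite subrr (vnorm0 hn) ltW.
Qed.

Lemma represents_eq f g x : (forall u, 0 <= u <= 1 -> f u = g u) ->
  represents f x -> represents g x.
Proof.
by move=> fg hf e /hf[q [h1 h2]]; exists q; split=> // u hu; rewrite -fg // h1.
Qed.

Lemma represents_le f x M : 0 <= M -> represents f x ->
  (forall u, 0 <= u <= 1 -> `|f u| <= M) -> nrm x <= M.
Proof.
move=> M0 hf fM; apply/ler_addgt0Pr => e e0.
have e20 : 0 < e / 2 by rewrite divr_gt0.
have [q [h1 h2]] := hf _ e20.
have h3 : nrm (act t a q a) <= M + e / 2.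
  apply: (nrm_act_le K_gt0 hE a1); first by rewrite ltr_wpDl.
  move=> u hu; rewrite -(subKr (f u) q.[u]); apply: le_trans (ler_normB _ _) _.
  by rewrite lerD ?fM ?h1.
have := vnorm_triangle hn x (act t a q a); lra.
Qed.

Lemma representsB f g x y : represents f x -> represents g y ->
  represents (fun u => f u - g u) (x - y).
Proof.
move=> hf hg e e0; have e20 : 0 < e / 2 by rewrite divr_gt0.
have [p [h1 h2]] := hf _ e20; have [q [h3 h4]] := hg _ e20.
exists (p - q); split=> [u hu|].
  rewrite hornerD hornerN (_ : _ - _ - _ = (f u - p.[u]) - (g u - q.[u])); last ring.
  by apply: le_trans (ler_normB _ _) _; rewrite [e]splitr lerD ?h1 ?h3.
rewrite (linear_sub (act_linear_poly _ _ _)) opprD addrACA -opprD.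
by apply: le_trans (vnormB hn _ _) _; rewrite [e]splitr lerD.
Qed.

Lemma represents_unique f x y : represents f x -> represents f y -> x = y.
Proof.
move=> hx hy; apply/eqP; rewrite -subr_eq0; apply/eqP/(vnorm_eq0 hn)/eqP.
rewrite eq_le nrm_ge0 andbT; apply: represents_le (representsB hx hy) _ => // u _.
by rewrite subrr normr0.
Qed.

Lemma represents_lim f x : (forall e, 0 < e -> exists g y, [/\ represents g y,
    forall u, 0 <= u <= 1 -> `|f u - g u| <= e & nrm (x - y) <= e]) ->
  represents f x.
Proof.
move=> hf e e0; have e20 : 0 < e / 2 by rewrite divr_gt0.
have [g [y [hg fg xy]]] := hf _ e20; have [q [h1 h2]] := hg _ e20.
exists q; split=> [u hu|]; rewrite [e]splitr.
  rewrite -(subrK (g u) (f u)) -addrA.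
  by apply: le_trans (ler_normD _ _) _; rewrite lerD ?fg ?h1.
rewrite -(subrK y x) -addrA.
by apply: le_trans (vnormD hn _ _) _; rewrite lerD.
Qed.

(** By [nrm_act_le], approximating polynomials of f give a Cauchy sequence of elements; its limit
    represents f. *)
Lemma represents_exists f : poly_approx f -> exists x, represents f x.
Proof.
move=> hf; pose e (n : nat) : R := n.+1%:R^-1.
have e0 n : 0 < e n by rewrite invr_gt0 ltr0n.
have e_mono i j : (i <= j)%N -> e j <= e i.
  by move=> ij; rewrite lef_pV2 ?posrE ?ltr0n // ler_nat ltnS.
have e_small d : 0 < d -> exists N, e N <= d.
  move=> d0; exists (Num.bound d^-1); rewrite /e invf_ple ?posrE ?ltr0n //.
  apply: le_trans (ltW (archi_boundP _)) _; first by rewrite invr_ge0 ltW.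
  by rewrite ler_nat.
have [q hq] := choice (fun n => hf (e n) (e0 n)).
have hd i j : nrm (act t a (q i) a - act t a (q j) a) <= e i + e j.
  rewrite -(linear_sub (act_linear_poly _ _ _)).
  apply: (nrm_act_le K_gt0 hE a1); first by rewrite addr_gt0.
  move=> u hu; rewrite hornerD hornerN.
  have -> : (q i).[u] - (q j).[u] = (f u - (q j).[u]) - (f u - (q i).[u]) by ring.
  by apply: le_trans (ler_normB _ _) _; rewrite addrC lerD ?hq.
have [d d0|l hl] := cubic_complete hE (u := fun n => act t a (q n) a).
  have [N hN] := e_small (d / 2) (divr_gt0 d0 (ltr0n R 2)).
  exists N => i j Ni Nj; apply: le_trans (hd i j) _.
  by have := e_mono _ _ Ni; have := e_mono _ _ Nj; lra.
exists l; apply: represents_lim => d d0.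
have [N hN] := e_small d d0; have [N' hN'] := hl d d0.
exists (fun u => (q (maxn N N')).[u]), (act t a (q (maxn N N')) a); split.
- exact: represents_poly.
- move=> u hu; apply: le_trans (hq _ u hu) _.
  by apply: le_trans (e_mono _ _ (leq_maxl N N')) hN.
- by rewrite (vnorm_distC hn); apply: hN'; rewrite leq_maxr.
Qed.

(** An extension principle: a bounded linear map that acts on polynomials in L(a,a) as
    multiplication by w does so on the whole functional calculus. *)
Lemma represents_map w (Phi : V -> V) (B : R) : linear Phi ->
  (forall x, nrm (Phi x) <= B * nrm x) -> (forall u, 0 <= u <= 1 -> `|w u| <= B) ->
  (forall q, represents (fun u => w u * q.[u]) (Phi (act t a q a))) ->
  forall f x, represents f x -> represents (fun u => w u * f u) (Phi x).
Proof.
move=> hPhi hB wB hq f x hf; apply: represents_lim => e e0.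
have B0 : 0 <= B.
  by apply: le_trans (wB 0 _); rewrite ?lexx ?ler01.
have B10 : 0 < B + 1 by rewrite ltr_wpDl.
have [q [h1 h2]] := hf (e / (B + 1)) (divr_gt0 e0 B10).
have eB : B * (e / (B + 1)) <= e.
  by rewrite mulrA ler_pdivrMr // mulrC ler_wpM2l ?ltW // ltrDl.
exists (fun u => w u * q.[u]), (Phi (act t a q a)); split=> // [u hu|].
  rewrite -mulrBr normrM; apply: le_trans eB.
  by apply: ler_pM => //; [exact: wB | exact: h1].
rewrite -(linear_sub hPhi); apply: le_trans (hB _) _; apply: le_trans eB.
by rewrite ler_wpM2l.
Qed.

Lemma act_bounded s : exists2 B, 0 <= B & forall x, nrm (act t a s x) <= B * nrm x.
Proof.
elim/poly_ind: s => [|s c [B B0 hB]].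
  by exists 0 => // x; rewrite (linear_0 (act_linear_poly _ _ _)) (vnorm0 hn) mul0r.
exists (B * K + `|c|) => [|x]; first by rewrite addr_ge0 // mulr_ge0 // ltW.
rewrite (linear_add (act_linear_poly _ _ _)) (actM ht) actX.
rewrite -[c%:P]mulr1 mul_polyC (linear_scale (act_linear_poly _ _ _)) act1.
apply: le_trans (vnormD hn _ _) _; rewrite (vnormZ hn) mulrDl lerD //.
apply: le_trans (hB _) _; rewrite -mulrA ler_wpM2l //.
by apply: le_trans (cubic_bound hE _ _ _) _; rewrite a1 !mulr1.
Qed.

Lemma represents_act s f x : represents f x ->
  represents (fun u => s.[u] * f u) (act t a s x).
Proof.
have [B B0 hB] := act_bounded s.
have [M M1 hM] := poly_approx_bounded (poly_approx_horner s).
apply: (@represents_map _ _ (Num.max B M)).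
- exact: act_linear.
- by move=> y; apply: le_trans (hB y) _; rewrite ler_wpM2r // le_max lexx.
- by move=> u hu; apply: le_trans (hM u hu) _; rewrite le_max lexx orbT.
move=> q; rewrite -(actM ht).
by apply: represents_eq (represents_poly _) => u _; rewrite hornerM.
Qed.

(** [triple_act] is extended from polynomials to functions one variable at a time, by
    [represents_map]. *)
Lemma represents_triple f g h x y z :
  represents f x -> represents g y -> represents h z ->
  represents (fun u => u * f u * g u * h u) (t x y z).
Proof.
have bnd (w : R -> R) v : represents w v ->
    exists2 M, 0 <= M & forall u, 0 <= u <= 1 -> `|w u| <= M.
  move=> /represents_poly_approx/poly_approx_bounded[M M1 hM].
  by exists M => //; exact: le_trans ler01 M1.
have bnd2 (w w' : R -> R) v v' : represents w v -> represents w' v' ->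
    exists2 M, 0 <= M & forall u, 0 <= u <= 1 -> `|u * w u * w' u| <= M.
  move=> /bnd[M M0 hM] /bnd[N N0 hN]; exists (M * N) => [|u hu].
    exact: mulr_ge0.
  rewrite !normrM ler_pM ?hN // -[leRHS]mul1r ler_pM ?hM //.
  by case/andP: hu => u0 u1; rewrite ger0_norm.
have h1 q r s : represents (fun u => u * q.[u] * r.[u] * s.[u])
    (t (act t a q a) (act t a r a) (act t a s a)).
  rewrite (triple_act ht); apply: represents_eq (represents_poly _) => u _.
  by rewrite !hornerM hornerX.
have h2 r s : represents f x ->
    represents (fun u => u * r.[u] * s.[u] * f u) (t x (act t a r a) (act t a s a)).
  have [M M0 hM] := bnd2 _ _ _ _ (represents_poly r) (represents_poly s).
  set b := act t a r a; set c := act t a s a.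
  (* The constant must dominate both the operator norm and the supremum of the multiplier; hence the
     sum. *)
  apply: (@represents_map _ (fun v => t v b c) (K * nrm b * nrm c + M)).
  - exact: triple_linl.
  - move=> v; apply: le_trans (cubic_bound hE _ _ _) _.
    rewrite mulrDl (_ : K * nrm v * nrm b * nrm c = K * nrm b * nrm c * nrm v); last ring.
    by rewrite lerDl mulr_ge0.
  - move=> u hu; apply: le_trans (hM u hu) _.
    by rewrite lerDr !mulr_ge0 // ltW.
  move=> q; apply: represents_eq (h1 q r s) => u _; ring.
move=> hf; have h3 s : represents g y ->
    represents (fun u => u * f u * s.[u] * g u) (t x y (act t a s a)).
  have [M M0 hM] := bnd2 _ _ _ _ hf (represents_poly s).
  set c := act t a s a.
  apply: (@represents_map _ (fun v => t x v c) (K * nrm x * nrm c + M)).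
  - exact: triple_linm.
  - move=> v; apply: le_trans (cubic_bound hE _ _ _) _.
    rewrite mulrDl (_ : K * nrm x * nrm v * nrm c = K * nrm x * nrm c * nrm v); last ring.
    by rewrite lerDl mulr_ge0.
  - move=> u hu; apply: le_trans (hM u hu) _.
    by rewrite lerDr !mulr_ge0 // ltW.
  move=> q; apply: represents_eq (h2 q s hf) => u _; ring.
move=> hg; have [M M0 hM] := bnd2 _ _ _ _ hf hg.
apply: (@represents_map _ (t x y) (K * nrm x * nrm y + M)).
- exact: triple_linr.
- move=> v; apply: le_trans (cubic_bound hE _ _ _) _.
  by rewrite mulrDl lerDl mulr_ge0.
- move=> u hu; apply: le_trans (hM u hu) _.
  by rewrite lerDr !mulr_ge0 // ltW.
move=> s; apply: represents_eq (h3 s hg) => u _; ring.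
Qed.

End FunctionalCalculus.

(** * Minimality of the norm *)

Section SecondNorm.
Variables (R : realType) (V : lmodType R) (t : V -> V -> V -> V) (nrm : V -> R).
Variables (K : R) (K_gt0 : 0 < K) (hE : cubic_triple t nrm K).
Variables (p : V -> R) (hp : vnorm p).
Hypothesis p_triple : forall x y z, p (t x y z) <= p x * p y * p z.

Let ht := cubic_jordan hE.
Let hn := cubic_vnorm hE.
Let p_ge0 := vnorm_ge0 hp.

Section Contraction.
Variables (a : V) (a1 : nrm a = 1) (pa : p a <= 10^-1).

Let rep := represents t nrm a.

(** The bump vanishes on [0, 3/4], which leaves a margin of 1/4 to the disc |l| < 1/2. *)
Let g (u : R) := Num.max 0 (u - 3 / 4).

Let g_approx : poly_approx g.
Proof.
apply: poly_approx_max; first exact: poly_approx_cst.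
exact: poly_approxB (@poly_approx_id R) (poly_approx_cst _).
Qed.

(** If b = 0, then {a,a,a}, of norm 1, is represented by u - g u, which is at most 3/4 on [0, 1]. *)
Lemma represents_cutoff_neq0 b : rep g b -> b != 0.
Proof.
move=> gb; apply/eqP => b0; rewrite b0 in gb.
have := representsB hE (represents_poly hE a 'X) gb; rewrite subr0 => h.
have : nrm (act t a 'X a) <= 3 / 4.
  apply: (represents_le K_gt0 hE a1 _ h) => // u /andP[u0 u1].
  rewrite hornerX /g; have [h1|h1] := leP 0 (u - 3 / 4).
    by rewrite (_ : u - (u - 3 / 4) = 3 / 4) ?ger0_norm //; ring.
  by rewrite subr0 ger0_norm //; lra.
rewrite actX (cubic_cube hE) a1 expr1n; lra.
Qed.

(* On the ideal generated by b the operator L(a,a) is bounded below by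
   inverses taken in the functional calculus, where no continuity of p is
   needed, while p contracts it. *)
Lemma contraction_absurd : False.
Proof.
have [b gb] := represents_exists K_gt0 hE a1 g_approx.
have b0 := represents_cutoff_neq0 gb.
pose n s := p (act t a s b).
have nD q s : n (q + s) <= n q + n s.
  by rewrite /n (linear_add (act_linear_poly _ _ _)) vnormD.
have nZ c s : n (c *: s) = `|c| * n s.
  by rewrite /n (linear_scale (act_linear_poly _ _ _)) (vnormZ hp).
have nX s : n ('X * s) <= 100^-1 * n s.
  rewrite /n (actM ht) actX; apply: le_trans (p_triple _ _ _) _.
  apply: ler_wpM2r => //; rewrite (_ : 100^-1 = 10^-1 * 10^-1); last by field.
  exact: ler_pM.
have K'0 : (0 : R) < 100^-1 by rewrite invr_gt0.
have hm := complexified_seminorm nD nZ; set m := complexified n in hm.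
have mX := complexifiedX nX; rewrite -/m in mX.
have m_below l : exists2 c, 0 < c & forall P, c * m P <= m (('X - l%:P) * P).
  (* For |l| >= 1/2 one has m (l P) >= m P / 4, the seminorm factor 2 included, while m (X P) <= m P
     / 100. *)
  have [l1|l1] := leP 2^-1 (cabs l).
    exists (4^-1 - 100^-1) => [|P]; first by lra.
    have l0 : l != 0.
      by apply: contraTneq l1 => ->; rewrite -ltNge ComplexField.Normc.normc0 invr_gt0.
    have h1 := poly_seminorm_triangle hm (l *: P) ('X * P).
    have e : l *: P - 'X * P = - (('X - l%:P) * P) by rewrite -mul_polyC; ring.
    rewrite e (poly_seminormN hm) in h1.
    have h2 := mX P; have h3 := poly_seminormZ hm l^-1 (l *: P).
    rewrite scalerA mulVf // scale1r ComplexField.Normc.normcV in h3.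
    have h4 : 2 * (cabs l)^-1 <= 4.
      have l0' : 0 < cabs l by apply: lt_le_trans l1; rewrite invr_gt0.
      by rewrite ler_pdivrMr //; lra.
    have := ler_wpM2r (poly_seminorm_ge0 hm (l *: P)) h4; lra.
  (* For |l| < 1/2 the real quadratic is inverted instead. Where g does not vanish, u - Re l >= 1/4
     and so Q u >= 1/16. *)
  apply: (complexified_below nD nZ K'0 nX).
  pose Q u := (conj_quad l).[u].
  have Q_low u : 3 / 4 <= u -> 16^-1 <= Q u.
    move=> hu; rewrite /Q /conj_quad !hornerE.
    have := le_lt_trans (cabs_Re l) l1; rewrite ltr_norml => /andP[_ h1].
    have h2 : 4^-1 <= u - complex.Re l by lra.
    have := sqr_ge0 (complex.Im l).
    have : 4^-1 * 4^-1 <= (u - complex.Re l) * (u - complex.Re l) by apply: ler_pM.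
    rewrite -expr2; lra.
  (* For u >= 3/4 this is 1 / (u Q u), and the truncations keep it continuous on [0, 1]. As g
     vanishes elsewhere, u w Q s g = s g. Thus {v, a, .} inverts Q(L(a,a)) on the elements s(L(a,a))
     b, and it is p-bounded by p v p a. *)
  pose w u := (Num.max u 2^-1 * Num.max (Q u) 16^-1)^-1.
  have [v wv] : exists v, rep w v.
    apply: (represents_exists K_gt0 hE a1).
    apply: (@poly_approxV _ _ (2^-1 * 16^-1)) => [|u hu|].
    - by rewrite mulr_gt0 // invr_gt0.
    - by rewrite ler_pM ?le_max ?lexx ?orbT.
    apply: poly_approxM; apply: poly_approx_max; try exact: poly_approx_cst.
      exact: poly_approx_id.
    exact: poly_approx_horner.
  exists (p v * p a + 1)^-1 => [|s]; first by rewrite invr_gt0 ltr_wpDl // mulr_ge0.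
  have h0 : 0 < p v * p a + 1 by rewrite ltr_wpDl // mulr_ge0.
  rewrite ler_pdivrMl // {1}/n.
  have <- : t v a (act t a (conj_quad l * s) b) = act t a s b.
    have h1 : rep (fun=> 1) a.
      have := represents_poly hE a 1; rewrite act1.
      by apply: represents_eq => u _; rewrite hornerC.
    have h2 := represents_triple K_gt0 hE wv h1
      (represents_act K_gt0 hE a1 (conj_quad l * s) gb).
    apply: (represents_unique K_gt0 hE a1 h2).
    apply: represents_eq (represents_act K_gt0 hE a1 s gb) => u hu.
    rewrite hornerM -/(Q u) mulr1 /g; have [h3|h3] := leP 0 (u - 3 / 4); last first.
      by rewrite !mulr0.
    have u34 : 3 / 4 <= u by lra.
    have hQ := Q_low u u34.
    rewrite /w (max_l hQ) max_l; last by lra.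
    by field; rewrite !gt_eqF //; lra.
  apply: le_trans (p_triple _ _ _) _; rewrite ler_wpM2r // lerDl //.
(* The lower bound at l = 0 makes m (X^k) at least c^k m 1, while [growth_bound] with disc radius c
   / 4 gives at most C (c / 2)^k m 1. *)
have [c c0 hc] := m_below 0.
have r00 : 0 < c / 4 by rewrite divr_gt0.
have r0r : c / 4 < c / 2 by lra.
have [C C0 hC] := growth_bound hm r00 K'0 mX (fun l _ => m_below l) r0r.
have lower k : c ^+ k * m 1 <= m ('X^k * 1).
  elim: k => [|k IH]; first by rewrite !expr0 !mul1r.
  rewrite !exprS -!mulrA; apply: le_trans (_ : c * m ('X^k * 1) <= _).
    by rewrite ler_pM2l.
  by have := hc ('X^k * 1); rewrite subr0.
have m1 : 0 < m 1.
  have := complexified_real nZ 1; rewrite rmorph1 -/m => ->.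
  by rewrite /n act1 (vnorm_gt0 hp).
have [N /(_ N (leqnn N)) hN] := expr_unbounded C (ltr1n R 2).
have := le_trans (lower N) (hC N 1); rewrite ler_pM2r // expr_div_n mulrA.
rewrite ler_pdivlMr ?exprn_gt0 // mulrC ler_pM2r ?exprn_gt0 //.
by rewrite leNgt hN.
Qed.

End Contraction.

(** If p y < 1 = nrm y, the powers y^(3^N) keep norm 1 while p of them tends to 0; once it is below
    1/10, [contraction_absurd] applies. *)
Lemma nrm_le_second_norm x : nrm x <= p x.
Proof.
rewrite leNgt; apply/negP => hx.
have nx : 0 < nrm x by exact: le_lt_trans hx.
pose y := (nrm x)^-1 *: x.
have y1 : nrm y = 1 by rewrite (vnormZ hn) gtr0_norm ?invr_gt0 // mulVf ?gt_eqF.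
have py : p y < 1 by rewrite (vnormZ hp) gtr0_norm ?invr_gt0 // ltr_pdivrMl // mulr1.
have p_pow j : p (tpow t y (cube_exp j)) <= p y ^+ (3 ^ j).
  elim: j => [|j IH]; first by rewrite expr1.
  rewrite (_ : cube_exp j.+1 = (3 * cube_exp j).+1) //.
  have -> : tpow t y (3 * cube_exp j).+1 =
      t (tpow t y (cube_exp j)) (tpow t y (cube_exp j)) (tpow t y (cube_exp j)).
    by rewrite (triple_tpow ht); congr (tpow t y _); lia.
  apply: le_trans (p_triple _ _ _) _.
  rewrite expnSr exprM !exprS expr0 mulr1 mulrA.
  by rewrite !ler_pM ?mulr_ge0.
have pyp : 0 < p y.
  by apply: (vnorm_gt0 hp); apply: contra_eqN y1 => /eqP ->; rewrite (vnorm0 hn) eq_sym oner_eq0.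
have py1 : 1 < (p y)^-1 by rewrite invf_gt1.
have [N hN] := expr_unbounded 10 py1.
have {}hN := hN (3 ^ N)%N (ltnW (ltn_expl N (isT : 1 < 3)%N)).
apply: (contraction_absurd (a := tpow t y (cube_exp N))).
  by rewrite (tpow_cube_exp K_gt0 hE) y1 expr1n.
apply: le_trans (p_pow N) _; rewrite -[leLHS]invrK -exprVn.
by rewrite lef_pV2 ?posrE ?exprn_gt0 ?invr_gt0 // ltW.
Qed.

End SecondNorm.

(** * Restriction of scalars to the reals *)

Section ScalarEmbedding.
Variables (R : realType) (k : scalar_kind).
Implicit Types (c d : R) (z : scalar_field R k).

Definition embed : R -> scalar_field R k :=
  match k return R -> scalar_field R k with
  | RealScalars => fun c => c
  | ComplexScalars => real_complex R
  end.

(** Norms take values in [scalar_field R k]; this map brings them back to R. *)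
Definition realpart : scalar_field R k -> R :=
  match k return scalar_field R k -> R with
  | RealScalars => fun c => c
  | ComplexScalars => @complex.Re R
  end.

Lemma embedD c d : embed (c + d) = embed c + embed d.
Proof. by rewrite /embed; case: k => //=; rewrite rmorphD. Qed.

Lemma embedM c d : embed (c * d) = embed c * embed d.
Proof. by rewrite /embed; case: k => //=; rewrite rmorphM. Qed.

Lemma embed0 : embed 0 = 0.
Proof. by rewrite /embed; case: k. Qed.

Lemma embed1 : embed 1 = 1.
Proof. by rewrite /embed; case: k. Qed.

Lemma embed_le c d : (embed c <= embed d) = (c <= d).
Proof. by rewrite /embed; case: k => //=; exact: lecR. Qed.

Lemma embed_lt c d : (embed c < embed d) = (c < d).
Proof. by rewrite /embed; case: k => //=; exact: ltcR. Qed.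

Lemma embed_gt0 c : (0 < embed c) = (0 < c).
Proof. by rewrite -embed_lt embed0. Qed.

Lemma embed_norm c : `|embed c| = embed `|c|.
Proof.
by rewrite /embed; case: k => //=; rewrite normc_def /= expr0n addr0 sqrtr_sqr.
Qed.

Lemma embedK z : 0 <= z -> embed (realpart z) = z.
Proof.
by move: z; rewrite /embed /realpart; case: k => //= z /ger0_real/RRe_real.
Qed.

Lemma embed_conj c : scalar_conj (embed c) = embed c.
Proof. by rewrite /embed; case: k => //=; rewrite oppr0. Qed.

End ScalarEmbedding.

(** A type synonym, so that the real module structure can be put on the carrier of E beside the one
    over [scalar_field R k]. *)
Definition restrict (R : realType) (k : scalar_kind)
  (E : lmodType (scalar_field R k)) : Type := E.

Section RestrictScalars.
Variables (R : realType) (k : scalar_kind) (E : lmodType (scalar_field R k)).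

HB.instance Definition _ := GRing.Zmodule.copy (restrict E) E.

Definition restrict_scale (c : R) (x : restrict E) : restrict E :=
  embed k c *: (x : E).

Let scaleA c d x : restrict_scale c (restrict_scale d x) = restrict_scale (c * d) x.
Proof. by rewrite /restrict_scale scalerA embedM. Qed.

Let scale1 : left_id 1 restrict_scale.
Proof. by move=> x; rewrite /restrict_scale embed1 scale1r. Qed.

Let scaleDr : right_distributive restrict_scale +%R.
Proof. by move=> c x y; exact: scalerDr. Qed.

Let scaleDl x : {morph restrict_scale^~ x : c d / c + d}.
Proof. by move=> c d; rewrite /restrict_scale embedD scalerDl. Qed.

HB.instance Definition _ := GRing.Zmodule_isLmodule.Build R (restrict E)
  scaleA scale1 scaleDr scaleDl.

Lemma restrict_scaleE (c : R) (x : restrict E) : c *: x = embed k c *: (x : E).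
Proof. by []. Qed.

End RestrictScalars.

Section RestrictNorm.
Variables (R : realType) (k : scalar_kind) (E : normedModType (scalar_field R k)).

Definition rnorm (x : restrict E) : R := realpart `|x : E|.

Lemma embed_rnorm x : embed k (rnorm x) = `|x : E|.
Proof. by rewrite embedK. Qed.

Lemma rnorm_vnorm : vnorm rnorm.
Proof.
split=> [x y|c x|x].
- by rewrite -(embed_le k) embedD !embed_rnorm ler_normD.
- apply/eqP; rewrite eq_le -!(embed_le k) -eq_le; apply/eqP.
  by rewrite embedM !embed_rnorm -embed_norm -normrZ.
- by move=> /(congr1 (embed k)); rewrite embed_rnorm embed0 => /normr0_eq0.
Qed.

End RestrictNorm.

Section RestrictTopology.
Variables (R : realType) (k : scalar_kind).
Implicit Types (E : normedModType (scalar_field R k)).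

Lemma cvg_rnormP E (u : nat -> E) (l : E) :
  (u n @[n --> \oo] --> l) <-> (forall e : R, 0 < e -> exists N, forall n, (N <= n)%N ->
    @rnorm R k E (u n - l) <= e).
Proof.
split=> [/cvgrPdist_le h e e0|h].
  have e0' : 0 < embed k e by rewrite embed_gt0.
  have [N _ hN] := h _ e0'; exists N => n /hN /=.
  by rewrite -(embed_le k) embed_rnorm distrC.
apply/cvgrPdist_le => e e0; have ee := embedK (ltW e0).
have [|N hN] := h (realpart e); first by rewrite -(embed_lt k) ee embed0.
exists N => // n /= /hN; by rewrite -(embed_le k) embed_rnorm ee distrC.
Qed.

Lemma rnorm_ball E (r : R) (x : E) : @rnorm R k E x < r -> ball (0 : E) (embed k r) x.
Proof.
by move=> h; rewrite -ball_normE /= sub0r normrN -embed_rnorm embed_lt.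
Qed.

Lemma real_radius (e : scalar_field R k) : 0 < e -> exists2 r : R, 0 < r & e = embed k r.
Proof.
move=> e0; exists (realpart e); last by rewrite embedK // ltW.
by rewrite -(embed_lt k) embedK ?embed0 // ltW.
Qed.

Lemma continuous_rnorm_bounded E (f : restrict E -> restrict E) : linear f ->
  continuous (f : E -> E) -> exists2 B, 0 < B & forall x : restrict E, rnorm (f x) <= B * rnorm x.
Proof.
move=> hf /(_ 0); have hv := rnorm_vnorm E.
have f0 : f 0 = 0 by exact: linear_0.
move=> /(_ _ (nbhsx_ballx _ _ ltr01)) /nbhs_ballP [e /= e0].
have [r r0 ->] := real_radius e0 => hr.
exists (2 / r) => [|x]; first by rewrite divr_gt0.
(* Rescaling x to norm r / 2 puts it inside the open ball of radius r. *)
have [->|x0] := eqVneq x 0; first by rewrite f0 (vnorm0 hv) mulr0.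
have nx := vnorm_gt0 hv x0; pose c := r / 2 / rnorm x.
have c0 : 0 < c by rewrite !divr_gt0.
have /hr : ball (0 : E) (embed k r) (c *: (x : restrict E) : restrict E).
  apply: rnorm_ball; rewrite (vnormZ hv) gtr0_norm // /c divfK ?gt_eqF //; lra.
rewrite /= -ball_normE /= (linear_scale hf) f0 sub0r normrN.
rewrite -(embed_rnorm (E := E)) -(embed1 R k) embed_lt (vnormZ hv) gtr0_norm // => h.
have -> : 2 / r * rnorm x = c^-1 by rewrite /c; field; rewrite !gt_eqF.
by rewrite ltW // -[c^-1]mulr1 ltr_pdivlMl.
Qed.

Lemma normed_jordan_triple_restrict E (t : E -> E -> E -> E) :
  normed_jordan_triple (@scalar_conj R k) t ->
  jordan_triple (t : restrict E -> restrict E -> restrict E -> restrict E).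
Proof.
move=> [_ [_ [tC [tl [tr [tm tJ]]]]]]; split=> [|y z c x x'|x z c y y'|] //.
- by rewrite restrict_scaleE; exact: tl.
- by rewrite restrict_scaleE tm embed_conj.
Qed.

Lemma normed_jordan_triple_bounded E (t : E -> E -> E -> E) :
  normed_jordan_triple (@scalar_conj R k) t ->
  exists2 K, 0 < K & forall x y z : restrict E,
    rnorm (t x y z : restrict E) <= K * rnorm x * rnorm y * rnorm z.
Proof.
move=> ht; have hJ := normed_jordan_triple_restrict ht; have hv := rnorm_vnorm E.
have [_ [tcont _]] := ht; have := tcont (0, 0, 0).
have t0l (y z : restrict E) : t 0 y z = 0 := linear_0 (triple_linl hJ y z).
have t0m (x z : restrict E) : t x 0 z = 0 := linear_0 (triple_linm hJ x z).
have t0r (x y : restrict E) : t x y 0 = 0 := linear_0 (triple_linr hJ x y).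
move=> /(_ _ (nbhsx_ballx _ _ ltr01)) /nbhs_ballP [e /= e0].
have [r r0 ->] := real_radius e0 => hr.
exists ((2 / r) ^+ 3) => [|x y z]; first by rewrite exprn_gt0 // divr_gt0.
have n0 := vnorm0 hv.
have [->|x0] := eqVneq x 0; first by rewrite t0l n0 mulr0 !mul0r.
have [->|y0] := eqVneq y 0; first by rewrite t0m n0 mulr0 !mul0r.
have [->|z0] := eqVneq z 0; first by rewrite t0r n0 mulr0.
pose c (v : restrict E) := r / 2 / rnorm v.
have c0 v : v != 0 -> 0 < c v.
  by move=> v0; rewrite !divr_gt0 //; exact: (vnorm_gt0 hv).
have cball (v : restrict E) : v != 0 -> ball (0 : E) (embed k r) (c v *: v).
  move=> v0; have nv := vnorm_gt0 hv v0.
  apply: rnorm_ball; rewrite (vnormZ hv) gtr0_norm ?c0 // /c divfK ?gt_eqF //; lra.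
pose s (v : restrict E) : restrict E := c v *: v.
have /= := hr (s x, s y, s z) (conj (conj (cball x x0) (cball y y0)) (cball z z0)).
rewrite -ball_normE /= t0l sub0r normrN /s.
rewrite (linear_scale (triple_linl hJ _ _)) (linear_scale (triple_linm hJ _ _)).
rewrite (linear_scale (triple_linr hJ _ _)) -(embed_rnorm (E := E)) -(embed1 R k) embed_lt.
have cx := c0 x x0; have cy := c0 y y0; have cz := c0 z z0.
rewrite !(vnormZ hv) (gtr0_norm cx) (gtr0_norm cy) (gtr0_norm cz) => h.
have nx := vnorm_gt0 hv x0; have ny := vnorm_gt0 hv y0; have nz := vnorm_gt0 hv z0.
have -> : (2 / r) ^+ 3 * rnorm x * rnorm y * rnorm z = (c x * c y * c z)^-1.
  by rewrite /c; field; rewrite !gt_eqF.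
have c3 : 0 < c x * c y * c z by rewrite mulr_gt0 // mulr_gt0.
apply: ltW; rewrite -[_^-1]mulr1 ltr_pdivlMl //; move: h.
by congr (_ < 1); rewrite -[RHS]mulrA -[RHS]mulrA.
Qed.

Lemma rnorm_complete (E : completeNormedModType (scalar_field R k)) (u : nat -> E) :
  (forall e : R, 0 < e -> exists N, forall i j, (N <= i)%N -> (N <= j)%N ->
    @rnorm R k E (u i - u j) <= e) ->
  exists l : E, forall e : R, 0 < e -> exists N, forall i, (N <= i)%N ->
    @rnorm R k E (u i - l) <= e.
Proof.
move=> hu; have : cvg (u n @[n --> \oo]).
  apply/cauchy_cvgP; apply/cauchy_exP => e e0.
  have [r r0 ->] := real_radius e0.
  have [N hN] := hu (r / 2) (divr_gt0 r0 (ltr0n R 2)).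
  exists (u N); exists N => // n /= Nn; rewrite -ball_normE /= -(embed_rnorm (E := E)) embed_lt.
  by apply: le_lt_trans (hN _ _ (leqnn N) Nn) _; lra.
by move=> hc; exists (lim (u n @[n --> \oo])); apply/cvg_rnormP.
Qed.

End RestrictTopology.

(** * Lower bounds from the spectral axioms *)

Lemma act_conj_quad (R : realType) (V : lmodType R) (t : V -> V -> V -> V) a
    (l : R[i]) y : jordan_triple t ->
  act t a (conj_quad l) y =
  (t a a (t a a y - complex.Re l *: y) - complex.Re l *: (t a a y - complex.Re l *: y))
    + complex.Im l ^+ 2 *: y.
Proof.
move=> ht.
have actC c x : act t a c%:P x = c *: x.
  by rewrite -[c%:P]mulr1 mul_polyC (linear_scale (act_linear_poly _ _ _)) act1.
have actXC c x : act t a ('X - c%:P) x = t a a x - c *: x.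
  by rewrite (linear_sub (act_linear_poly _ _ _)) actX actC.
by rewrite (linear_add (act_linear_poly _ _ _)) actC expr2 (actM ht) !actXC.
Qed.

(** (L - d)(L - c) depends only on c + d and c d. This identifies (L - l)(L - conj l) with (L - Re
    l)^2 + (Im l)^2. *)
Lemma quadratic_operator (K : comNzRingType) (V : lmodType K) (L : V -> V)
    (c d c' d' e : K) y : linear L -> c + d = c' + d' -> c * d = c' * d' + e ->
  L (L y - c *: y) - d *: (L y - c *: y) =
  L (L y - c' *: y) - d' *: (L y - c' *: y) + e *: y.
Proof.
move=> hL hs hp.
have expand a b : L (L y - a *: y) - b *: (L y - a *: y) =
    L (L y) - (a + b) *: L y + (a * b) *: y.
  have -> : L (L y - a *: y) = L (L y) - a *: L y.
    by rewrite addrC -scaleNr hL addrC scaleNr.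
  by rewrite scalerBr scalerA scalerDl [b * a]mulrC !opprD opprK !addrA.
by rewrite !expand hs hp -[RHS]addrA -scalerDl.
Qed.

(** With l, also conj l lies outside [0, +oo), so both L(a,a) - l and L(a,a) - conj l have bounded
    left inverses; composing them inverts the quadratic. *)
Lemma JBstar_below (R : realType)
    (E : completeNormedModType (scalar_field R ComplexScalars)) (t : E -> E -> E -> E) :
  JBstar_triple (t : (E : completeNormedModType R[i]) -> _) -> forall a (l : R[i]), ~ (0 <= l) ->
  exists2 c, 0 < c & forall x : restrict E, c * rnorm x <=
    rnorm (act (t : restrict E -> restrict E -> restrict E -> restrict E) a (conj_quad l) x).
Proof.
move=> [ht [_ [hsp _]]] a l hl.
have hJ := @normed_jordan_triple_restrict R ComplexScalars E t ht.
have resolvent (z : R[i]) : ~ (0 <= z) -> exists g : restrict E -> restrict E,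
    (exists2 B, 0 < B & forall x, rnorm (g x) <= B * rnorm x) /\
    forall x, g (t a a x - (z : scalar_field R ComplexScalars) *: (x : E)) = x.
  move=> hz; have : ~ spectrum (t a a : E -> E) z by move=> /hsp.
  move=> /contrapT[g [[glin gcont] hg _]]; exists g; split => //.
  apply: continuous_rnorm_bounded => // c x y.
  by rewrite restrict_scaleE; exact: glin.
have hl' : ~ (0 <= conjc l) by rewrite conj_ge0.
have [g [[B B0 gB] hg]] := resolvent _ hl.
have [g' [[B' B'0 g'B] hg']] := resolvent _ hl'.
exists (B * B')^-1 => [|y]; first by rewrite invr_gt0 mulr_gt0.
rewrite ler_pdivrMl ?mulr_gt0 //.
set Q := act _ _ _ _; have -> : y = g' (g Q).
  apply: etrans (esym (hg' y)) _; congr g'.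
  apply: etrans (esym (hg _)) _; congr g.
  have tlin : linear (t a a : E -> E) by move: ht => [_ [_ [_ [_ [tr _]]]]]; exact: tr.
  rewrite /Q (act_conj_quad _ _ _ hJ) !restrict_scaleE.
  apply: (quadratic_operator _ tlin); case: (l) => x1 y1; rewrite /embed; simpc => /=.
    by congr (_ +i* _); ring.
  by congr (_ +i* _); ring.
apply: le_trans (g'B _) _; rewrite [B * _]mulrC -mulrA ler_pM2l //.
Qed.

(** Let S1 + i S2 be the inverse of L(a,a) - l, A = L(a,a) - Re l and b = Im l. Being a left inverse
    means S1 A = 1 - b S2 and S2 A = b S1. For Q = A^2 + b^2 these give S1 Q = A and S2 Q = b,
    whence S1^2 Q + S2^2 Q = 1. *)
Lemma JstarB_below (R : realType)
    (E : completeNormedModType (scalar_field R RealScalars)) (t : E -> E -> E -> E) :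
  JstarB_triple (t : (E : completeNormedModType R) -> _) -> forall a (l : R[i]), ~ (0 <= l) ->
  exists2 c, 0 < c & forall x : restrict E, c * rnorm x <=
    rnorm (act (t : restrict E -> restrict E -> restrict E -> restrict E) a (conj_quad l) x).
Proof.
move=> [ht [_ [_ [hsp _]]]] a l hl.
have hJ := @normed_jordan_triple_restrict R RealScalars E t ht.
have : ~ complex_spectrum (t a a : E -> E) l by move=> /hsp.
move=> /contrapT[[S1 S2] /= [[lin1 cont1] [lin2 cont2] e1 _]].
pose A (z : restrict E) : restrict E := t a a z - complex.Re l *: z.
have lin1' : linear (S1 : restrict E -> restrict E) by exact: lin1.
have lin2' : linear (S2 : restrict E -> restrict E) by exact: lin2.
have [B1 B10 hB1] := continuous_rnorm_bounded lin1' cont1.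
have [B2 B20 hB2] := continuous_rnorm_bounded lin2' cont2.
have S1A (z : restrict E) : S1 (A z) = z - complex.Im l *: (S2 z : restrict E).
  have h : (S1 (A z) : restrict E) - S2 (- (complex.Im l *: z)) = z :=
    congr1 (fun S => S.1 z) e1.
  have n2 : S2 (- (complex.Im l *: z)) = - (complex.Im l *: (S2 z : restrict E)).
    by rewrite -scaleNr (linear_scale lin2') scaleNr.
  by apply/eqP; rewrite eq_sym subr_eq; rewrite n2 opprK in h; rewrite h.
have S2A (z : restrict E) : S2 (A z) = complex.Im l *: (S1 z : restrict E).
  have h : (S1 (- (complex.Im l *: z)) : restrict E) + S2 (A z) = 0 :=
    congr1 (fun S => S.2 z) e1.
  apply/eqP; rewrite -subr_eq0 -[X in _ == X]h addrC; apply/eqP; congr (_ + _).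
  by rewrite -scaleNr -[in RHS]scaleNr (linear_scale lin1').
exists (B1 ^+ 2 + B2 ^+ 2)^-1 => [|y].
  by rewrite invr_gt0 addr_gt0 // exprn_gt0.
rewrite ler_pdivrMl; last by rewrite addr_gt0 // exprn_gt0.
rewrite (act_conj_quad _ _ _ hJ) -/(A y) -/(A (A y)).
set b := complex.Im l in S1A S2A *; set Q : restrict E := A (A y) + _.
have S1Q : S1 Q = A y.
  by rewrite (linear_add lin1') S1A S2A (linear_scale lin1') scalerA -expr2 subrK.
have S2Q : S2 Q = b *: (y : restrict E).
  by rewrite (linear_add lin2') S2A S1A (linear_scale lin2') scalerBr scalerA -expr2 subrK.
have ey : (y : restrict E) = (S1 (S1 Q) : restrict E) + S2 (S2 Q).
  by rewrite S1Q S2Q S1A (linear_scale lin2') subrK.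
have hv := rnorm_vnorm (k := RealScalars) E.
have h1 : rnorm (S1 (S1 Q) : restrict E) <= B1 ^+ 2 * rnorm Q.
  by apply: le_trans (hB1 _) _; rewrite expr2 -mulrA ler_pM2l.
have h2 : rnorm (S2 (S2 Q) : restrict E) <= B2 ^+ 2 * rnorm Q.
  by apply: le_trans (hB2 _) _; rewrite expr2 -mulrA ler_pM2l.
rewrite {1}ey mulrDl; apply: le_trans (vnormD hv _ _) _; exact: lerD.
Qed.

Lemma JB_cubic_triple (R : realType) (k : scalar_kind)
    (E : completeNormedModType (scalar_field R k)) (t : E -> E -> E -> E) :
  JBstar_or_JstarB_triple t -> exists2 K, 0 < K &
  @cubic_triple R (restrict E) (t : restrict E -> restrict E -> restrict E -> restrict E)
    (@rnorm R k E) K.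
Proof.
move=> hE.
have ht : normed_jordan_triple (@scalar_conj R k) t by move: hE; case: k E t => E t [].
have [K K0 hK] := normed_jordan_triple_bounded ht; exists K => //; split => //.
- exact: normed_jordan_triple_restrict.
- exact: rnorm_vnorm.
- have cube (a : E) : `|t a a a| = `|a| ^+ 3.
    move: hE; clear; case: k E t a => E t a.
      by move=> [_ [-> _]].
    by move=> [_ [_ [_ ->]]].
  move=> a; apply/eqP; rewrite eq_le -!(embed_le k) -eq_le; apply/eqP.
  by rewrite !exprS expr0 mulr1 !embedM !embed_rnorm -expr2 -exprS.
- move: hE; clear; case: k E t => E t.
    exact: JstarB_below.
  exact: JBstar_below.
- exact: rnorm_complete.
Qed.


(** * Triple monomorphisms and the closure of their range *)

Lemma embed_to_complex (R : realType) (k k' : scalar_kind) (c : R) :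
  scalar_to_complex (embed k c) = scalar_to_complex (embed k' c).
Proof. by case: k; case: k'. Qed.

Lemma triple_monomorphism_linear (R : realType) (kE kF : scalar_kind)
    (E : lmodType (scalar_field R kE)) (tE : E -> E -> E -> E)
    (F : lmodType (scalar_field R kF)) (tF : F -> F -> F -> F) (T : E -> F) :
  triple_monomorphism tE tF T -> linear (T : restrict E -> restrict F).
Proof.
move=> [[TD TZ] _] c x y; rewrite TD !restrict_scaleE; congr (_ + _).
by apply: TZ; exact: embed_to_complex.
Qed.

(** Scaling |T x| by s = sqrt KF absorbs the bound of the triple product of F, since s KF = s^3.
    Injectivity makes the result a norm, so [nrm_le_second_norm] applies. *)
Lemma triple_monomorphism_below (R : realType) (kE kF : scalar_kind)
    (E : completeNormedModType (scalar_field R kE)) (tE : E -> E -> E -> E)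
    (F : normedModType (scalar_field R kF)) (tF : F -> F -> F -> F) (T : E -> F) :
  JBstar_or_JstarB_triple tE -> normed_jordan_triple (@scalar_conj R kF) tF ->
  triple_monomorphism tE tF T -> exists2 C, 0 < C & forall x : restrict E,
    rnorm x <= C * rnorm (T x : restrict F).
Proof.
move=> hE hF hT; have Tlin := triple_monomorphism_linear hT.
have [_ [Tt Tinj]] := hT.
have [K K0 hK] := JB_cubic_triple hE.
have [KF KF0 hKF] := normed_jordan_triple_bounded hF.
have hvF := rnorm_vnorm F; pose s := Num.sqrt KF; have s0 : 0 < s by rewrite sqrtr_gt0.
exists s => // x.
apply: (nrm_le_second_norm K0 hK (p := fun x => s * rnorm (T x : restrict F))).
- split=> [y z|c y|y].
  + by rewrite (linear_add Tlin) -mulrDr ler_pM2l // (vnormD hvF).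
  + by rewrite (linear_scale Tlin) (vnormZ hvF) mulrCA.
  + move=> /eqP; rewrite mulf_eq0 gt_eqF //= => /eqP/(vnorm_eq0 hvF) Ty.
    by apply: Tinj; rewrite Ty (linear_0 Tlin).
- move=> y z w; rewrite Tt; set a := rnorm _; set b := rnorm _.
  set c := rnorm (T z : restrict F); set d := rnorm (T w : restrict F).
  have h : a <= s ^+ 2 * b * c * d by rewrite sqr_sqrtr ?(ltW KF0) //; exact: hKF.
  have -> : s * b * (s * c) * (s * d) = s * (s ^+ 2 * b * c * d) by ring.
  by rewrite ler_pM2l.
Qed.

Theorem corollary18 (R : realType) (kE kF : scalar_kind)
  (E : completeNormedModType (scalar_field R kE)) (tE : E -> E -> E -> E)
  (F : normedModType (scalar_field R kF)) (tF : F -> F -> F -> F)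
  (Fh : completeNormedModType (scalar_field R kF)) (tFh : Fh -> Fh -> Fh -> Fh)
  (iota : F -> Fh) (T : E -> F)
  (hE : JBstar_or_JstarB_triple tE)
  (hF : normed_jordan_triple (@scalar_conj R kF) tF)
  (hFh : triple_completion (@scalar_conj R kF) tF tFh iota)
  (hT : triple_monomorphism tE tF T) :
  is_direct_sum (closure (range (iota \o T)))
    (range (iota \o T)) (separating_space (iota \o T)).
Proof.
have [C C0 hC] := triple_monomorphism_below hE hF hT.
have Tlin := triple_monomorphism_linear hT.
have [_ [iota_lin [iota_norm _]]] := hFh.
have lin_sub u v : iota (u - v) = iota u - iota v.
  by rewrite addrC -scaleN1r iota_lin scaleN1r addrC.
pose G : restrict E -> restrict Fh := iota \o T.
have G_sub (x y : restrict E) : G x - G y = G (x - y).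
  by rewrite /G /= (linear_sub Tlin) lin_sub.
have hvE := rnorm_vnorm E; have hvFh := rnorm_vnorm Fh.
have below (x : restrict E) : rnorm x <= C * rnorm (G x).
  apply: le_trans (hC x) _; rewrite ler_pM2l // -(embed_le kF) !embed_rnorm.
  by rewrite /G /= iota_norm.
have G0 : G 0 = 0 by rewrite -(subrr (0 : restrict E)) -G_sub subrr.
have GD (x y : restrict E) : G (x + y) = G x + G y.
  by apply/eqP; rewrite -subr_eq G_sub addrK.
split.
  apply/seteqP; split=> [z hz|_ [_ [a _ <-]] [b [x [x0 xb]] <-]]; last first.
    (* G a + b is the limit of G (a + x_n). *)
    move=> B /nbhs_ballP[e e0 hB].
    have [r r0 er] := real_radius e0; rewrite er in hB.
    have [N hN] := (cvg_rnormP _ _).1 xb (r / 2) (divr_gt0 r0 (ltr0n R 2)).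
    exists (G (a + x N)); split; first by exists (a + x N).
    apply: hB; rewrite -ball_normE /= -embed_rnorm embed_lt.
    have -> : iota (T a) + b - G (a + x N) = - (iota (T (x N)) - b).
      by rewrite GD opprD addrACA subrr add0r opprB.
    by rewrite (vnormN hvFh); apply: le_lt_trans (hN N (leqnn N)) _; lra.
  have approx (n : nat) : exists x : restrict E, rnorm (G x - z : restrict Fh) < n.+1%:R^-1.
    have e0 : 0 < embed kF (n.+1%:R^-1 : R).
      by rewrite embed_gt0 invr_gt0.
    have [_ [[x _ <-] /= hx]] := hz _ (nbhsx_ballx z _ e0).
    exists x; move: hx; rewrite -ball_normE /= -embed_rnorm embed_lt.
    by rewrite (vnorm_distC hvFh).
  have [x hx] := choice approx.
  have small (d : R) : 0 < d -> exists N, forall n, (N <= n)%N ->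
      rnorm (G (x n) - z : restrict Fh) <= d.
    move=> d0; exists (Num.bound d^-1) => n hn; apply: le_trans (ltW (hx n)) _.
    rewrite invf_ple ?posrE ?ltr0n //.
    apply: le_trans (ltW (archi_boundP _)) _; first by rewrite invr_ge0 ltW.
    by rewrite ler_nat leqW.
  (* The G (x_n) converge to z and G is bounded below, so x_n is Cauchy in the complete space E. *)
  have [e e0|l hl] := @rnorm_complete R kE E x.
    have [N hN] := small (e / 2 / C) (divr_gt0 (divr_gt0 e0 (ltr0n R 2)) C0).
    exists N => i j Ni Nj; apply: le_trans (below _) _.
    rewrite -G_sub mulrC -ler_pdivlMr //.
    have -> : G (x i) - G (x j) = (G (x i) - z) - (G (x j) - z).
      by rewrite opprB addrA subrK.
    apply: le_trans (vnormB hvFh _ _) _.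
    have h1 := hN _ Ni; have h2 := hN _ Nj; lra.
  exists (G l); first by exists l.
  (* The remainder is separating: x_n - l tends to 0 and G (x_n - l) to z - G l. *)
  exists (z - G l); last by rewrite addrC subrK.
  exists (fun n => x n - l); split; apply/cvg_rnormP => e e0.
    by have [N hN] := hl e e0; exists N => n /hN; rewrite subr0.
  have [N hN] := small e e0; exists N => n /hN; rewrite -[(iota \o T) _]/(G _) -G_sub.
  by rewrite opprB addrA subrK.
apply/seteqP; split=> [z [[a _ <-] [x [x0 xa]]]|_ ->]; last first.
  split; first by exists 0 => //; exact: G0.
  exists (fun=> 0); split; first exact: cvg_cst.
  have -> : (iota \o T) 0 = 0 := G0; exact: cvg_cst.
(* Here G x_n tends to G a with x_n tending to 0; the lower bound makes x_n tend to a as well. *)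
suff -> : a = 0 by exact: G0.
have [x0' xa'] := ((cvg_rnormP _ _).1 x0, (cvg_rnormP _ _).1 xa).
apply: (vnorm_eq0 hvE); apply/eqP; rewrite eq_le (vnorm_ge0 hvE) andbT.
apply/ler_addgt0Pr => e e0; rewrite add0r.
have e20 : 0 < e / 2 by rewrite divr_gt0.
have [N hN] := x0' (e / 2) e20.
have [N' hN'] := xa' (e / 2 / C) (divr_gt0 e20 C0).
have h1 := hN _ (leq_maxl N N'); have h2 := hN' _ (leq_maxr N N').
set n := maxn N N' in h1 h2; rewrite subr0 in h1.
have h3 : rnorm (x n - a : restrict E) <= e / 2.
  apply: le_trans (below _) _; rewrite -G_sub mulrC -ler_pdivlMr //.
have := vnorm_triangle hvE a (x n); rewrite (vnorm_distC hvE) => h4; lra.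
Qed.
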